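(* Let $M$ be a surface isometrically immersed in $\mathbb{E}^3$ whose angle function takes values in $(0,\pi)\setminus\{\frac{\pi}{2}\}$. Then $M$ is a flat surface with $U$ a canonical principal direction if and only if the immersion is, locally in suitable coordinates $(x,y)$ and up to isometries of the ambient space, given by $$r(x,y)=\left(\phi(x)\cos y_0,\ \phi(x)\sin y_0,\ \int_0^x\sin\theta(\tau)\,d\tau\right)+y\,\mathrm{v}_0,$$ where $\mathrm{v}_0=(-\sin y_0,\cos y_0,0)$, $y_0\in\mathbb{R}$, $\theta=\theta(x)$ is a smooth function with values in $(0,\pi)\setminus\{\frac{\pi}{2}\}$ and nowhere vanishing derivative, and $\phi(x)$ is a primitive of $\cos\theta(x)$.
   Context: $\mathbb{E}^3$ is Euclidean 3-space with scalar product $\langle\cdot,\cdot\rangle$ and a fixed unit vector (fixed direction) $\overrightarrow{k}$. $M$ is a smooth surface isometrically immersed in $\mathbb{E}^3$ with unit normal $N$ and shape operator $A$ given by $\widetilde\nabla_X N=-AX$, where $\widetilde\nabla$ is the flat connection. The angle function of $M$ is $\angle(N(p),\overrightarrow{k})\in(0,\pi)$, denoted $\theta$, and $U$ is the tangent part of $\overrightarrow{k}$: $\overrightarrow{k}=U+\cos\theta\,N$. ''$U$ is a principal direction'' means that $AU$ is everywhere a multiple of $U$; it is a canonical principal direction if moreover the corresponding principal curvature is different from zero everywhere (so the angle function is not constant). ''Flat'' means that the Gaussian curvature $K=\det A$ vanishes identically. The statement is local (in a neighborhood of any point). The isometries in question are those carrying $\overrightarrow{k}$ to the third coordinate vector $(0,0,1)$;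 in the parametrization the third coordinate is along $\overrightarrow{k}$. *)

(* Defs.v *)
From HB Require Import structures.
From mathcomp Require Import all_boot all_order all_algebra.
From mathcomp Require Import all_classical all_reals all_analysis.

Set Implicit Arguments.
Unset Strict Implicit.
Unset Printing Implicit Defensive.

Import Order.TTheory GRing.Theory Num.Theory.
Import numFieldNormedType.Exports.

Local Open Scope classical_set_scope.
Local Open Scope ring_scope.

(* The library norm on 'rV[R]_3 is the sup norm, so the Euclidean structure of
   E^3 is introduced here.  The two norms induce the same topology, hence the
   same notion of derivative. *)
Definition dot (R : realType) (u v : 'rV[R]_3) : R :=
  \sum_(i < 3) u 0 i * v 0 i.

Definition edist (R : realType) (u v : 'rV[R]_3) : R :=
  Num.sqrt (dot (u - v) (u - v)).

Definition vec3 (R : realType) (a b c : R) : 'rV[R]_3 :=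
  \row_(i < 3) [:: a; b; c]`_i.

(* C^oo on an open set D: all iterated directional derivatives are Frechet
   differentiable (hence continuous) at every point of D. *)
Definition smooth_on (R : realType) (V W : normedModType R)
    (D : set V) (f : V -> W) : Prop :=
  forall (s : seq V) (p : V), D p ->
    differentiable (foldr (fun v g => 'D_v g) f s) p.

(* A surface is a patch r : D -> E^3 on an open set D of R^2, with the induced
   metric.  A tangent vector at p is given by its coordinates v : 'rV_2, which
   represent the vector v *m 'J r p = 'D_v r p of E^3. *)
Definition immersion (R : realType) (D : set 'rV[R]_2)
    (r : 'rV[R]_2 -> 'rV[R]_3) : Prop :=
  smooth_on D r /\ forall p, D p -> row_free ('J r p).

Definition unit_normal (R : realType) (D : set 'rV[R]_2)
    (r N : 'rV[R]_2 -> 'rV[R]_3) : Prop :=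
  smooth_on D N /\
  forall p, D p ->
    dot (N p) (N p) = 1 /\ forall v, dot ('D_v r p) (N p) = 0.

Definition angle (R : realType) (k : 'rV[R]_3) (N : 'rV[R]_2 -> 'rV[R]_3)
    (p : 'rV[R]_2) : R :=
  acos (dot (N p) k).

(* Right multiplication by pinvmx ('J r p) returns the coordinates of a vector
   of E^3 lying in the tangent plane, which is the row space of 'J r p. *)

(* k = U + cos theta N. *)
Definition tangent_part (R : realType) (k : 'rV[R]_3)
    (r N : 'rV[R]_2 -> 'rV[R]_3) (p : 'rV[R]_2) : 'rV[R]_2 :=
  (k - cos (angle k N p) *: N p) *m pinvmx ('J r p).

(* 'D_v N = - A v; matrices act on row vectors from the right, so that A v is
   v *m shape_operator r N p. *)
Definition shape_operator (R : realType) (r N : 'rV[R]_2 -> 'rV[R]_3)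
    (p : 'rV[R]_2) : 'M[R]_2 :=
  - ('J N p *m pinvmx ('J r p)).

Definition gauss_curvature (R : realType) (r N : 'rV[R]_2 -> 'rV[R]_3)
    (p : 'rV[R]_2) : R :=
  \det (shape_operator r N p).

Definition flat (R : realType) (D : set 'rV[R]_2)
    (r N : 'rV[R]_2 -> 'rV[R]_3) : Prop :=
  forall p, D p -> gauss_curvature r N p = 0.

Definition canonical_principal_direction (R : realType) (k : 'rV[R]_3)
    (D : set 'rV[R]_2) (r N : 'rV[R]_2 -> 'rV[R]_3) : Prop :=
  exists kappa : 'rV[R]_2 -> R, forall p, D p ->
    tangent_part k r N p *m shape_operator r N p
      = kappa p *: tangent_part k r N p
    /\ kappa p != 0.

Definition diffeomorphism (R : realType) (W V : set 'rV[R]_2)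
    (F : 'rV[R]_2 -> 'rV[R]_2) : Prop :=
  smooth_on W F /\
  exists G : 'rV[R]_2 -> 'rV[R]_2,
    [/\ smooth_on V G,
        forall q, W q -> V (F q) /\ G (F q) = q
      & forall p, V p -> W (G p) /\ F (G p) = p].

Definition isometry (R : realType) (T : 'rV[R]_3 -> 'rV[R]_3) : Prop :=
  forall u v, edist (T u) (T v) = edist u v.

(* The differential of the isometry T maps k to l. *)
Definition carries (R : realType) (T : 'rV[R]_3 -> 'rV[R]_3)
    (k l : 'rV[R]_3) : Prop :=
  forall u, T (u + k) = T u + l.

Definition oriented_integral (R : realType) (a b : R) (f : R -> R) : R :=
  if a <= b then \int[lebesgue_measure]_(t in `[a, b]) f t
  else - \int[lebesgue_measure]_(t in `[b, a]) f t.

Definition cylinder_param (R : realType) (theta phi : R -> R) (y0 : R)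
    (x y : R) : 'rV[R]_3 :=
  vec3 (phi x * cos y0) (phi x * sin y0)
       (oriented_integral 0 x (fun t => sin (theta t)))
  + y *: vec3 (- sin y0) (cos y0) 0.

(* Near each point p of D there are an open neighborhood V of p in D and
   coordinates (x, y) on V (F is the inverse of the coordinate map) in which r
   has the stated form up to an isometry.  The functions of x live on an open
   interval I containing 0, so that the integrals from 0 to x make sense. *)
Definition locally_cylinder (R : realType) (k : 'rV[R]_3)
    (D : set 'rV[R]_2) (r : 'rV[R]_2 -> 'rV[R]_3) : Prop :=
  forall p, D p ->
  exists (V W : set 'rV[R]_2) (F : 'rV[R]_2 -> 'rV[R]_2)
         (T : 'rV[R]_3 -> 'rV[R]_3)
         (I : set R) (theta phi : R -> R) (y0 : R),
    [/\ [/\ open V, V p & V `<=` D],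
        open W /\ diffeomorphism W V F,
        isometry T /\ carries T k (vec3 0 0 1),
        [/\ open I, is_interval I, I 0,
            smooth_on I theta
          & forall x, I x ->
              [/\ 0 < theta x < pi, theta x != pi / 2,
                  derive1 theta x != 0
                & is_derive x 1 phi (cos (theta x))]]
      & forall q, W q ->
          I (q 0 0) /\
          T (r (F q)) = cylinder_param theta phi y0 (q 0 0) (q 0 1)].

(* Main.v *)
Require Import Defs.
From HB Require Import structures.
From mathcomp Require Import all_boot all_order all_algebra.
From mathcomp Require Import all_classical all_reals all_analysis.
From mathcomp Require Import ring lra.
Import Order.TTheory GRing.Theory Num.Theory.
Import numFieldNormedType.Exports.
Local Open Scope classical_set_scope.
Local Open Scope ring_scope.
Set Implicit Arguments.
Unset Strict Implicit.
Unset Printing Implicit Defensive.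

(** Write c = <N, k> for the cosine of the angle function and U = k - c N for
the tangent part of k.

Curvature.  If A U = kappa U with kappa <> 0 and det A = 0, then A has rank
one and its range is the line of U.  So the geometric hypothesis says that
every derivative of N is a multiple of U, and that the derivative of N along U
does not vanish [flat_canonical_iff].  Both implications of the theorem start
from this reformulation.

Rigidity.  Let D_v N = a U.  Then D_v c = a (1 - c^2), and h = <N, w>
satisfies D_v h = - a c h for every w orthogonal to k.  Hence h^2 / (1 - c^2)
is locally constant: a vector w orthogonal to k and to N at one point stays
orthogonal to N nearby [normal_in_vertical_plane].  Complete k and w to an
orthonormal frame (e, w, k), oriented so that N = c k - s e with s > 0, and
let xx, yy, zz be the coordinates of the surface in this frame.  The equation
<dr, N> = 0 becomes s dxx = c dzz.  In the chart (zz, yy) the function xx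
therefore depends on zz alone; its derivative is c / s, so c and s are
functions of zz too [height_determines_normal].  The arc length
x = \int dzz / s of the profile curve is thus a function on the surface, and
in the chart (x, yy) one reads dzz / dx = s = sin theta and
dxx / dx = c = cos theta, with theta a function of x
[framed_cylinder_exists].  Its derivative does not vanish because N varies
along U.

Converse.  On such a cylinder the unit vector N is orthogonal to the ruling w
and to the profile tangent E = cos theta e + sin theta k.  Differentiating
these relations gives D N = - sigma theta' dx E with sigma = 1 or -1, while
U = sin theta E [framed_cylinder_normal_derivative].

Both charts come from the inverse function theorem for smooth maps between
open sets of R^n, proved below by contraction [inverse_function].  Isometries
enter through the fact that they are affine with orthogonal linear part
[isometry_affine], which reduces the parametrization to coordinates in an
orthonormal frame containing k. *)

(** * Differentiability of vector-valued maps *)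

Section Differentiation.
Context {R : realType}.
Implicit Types V W : normedModType R.

(** The definition of the differential with explicit estimates, a form that
can be transported along local equality and checked for an inverse map. *)
Lemma is_diff_eps V W (f : V -> W) (df : {linear V -> W}) x :
  continuous df ->
  (forall e, 0 < e ->
     \forall h \near (0 : V), `|f (h + x) - f x - df h| <= e * `|h|) ->
  is_diff x f df.
Proof.
move=> dfc H.
have E : f \o shift x = cst (f x) + df +o_ 0 id.
  apply/eqaddoP => e e0; near=> h.
  rewrite opprD addrA /=.
  by near: h; exact: H.
have D := diff_unique dfc E.
by split => //; apply/diff_locallyP; rewrite D.
Unshelve. all: by end_near. Qed.

Lemma diff_eps V W (f : V -> W) x :
  differentiable f x -> forall e, 0 < e ->
     \forall h \near (0 : V), `|f (h + x) - f x - 'd f x h| <= e * `|h|.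
Proof.
move=> /diff_locally/eqaddoP + e e0 => /(_ e e0).
apply: filterS => h.
by rewrite opprD addrA.
Qed.

Lemma near_eq_differentiable V W (f g : V -> W) p :
  (\forall x \near p, f x = g x) -> differentiable f p -> differentiable g p.
Proof.
move=> fg df.
suff : is_diff p g ('d f p) by case.
apply: is_diff_eps; first exact: diff_continuous.
move=> e e0; have fgp := nbhs_singleton fg.
have fg0 : \forall h \near (0 : V), f (h + p) = g (h + p).
  move: fg; rewrite (near_shift 0) /= subr0; exact.
near=> h.
rewrite -fgp -(near fg0 h) //; near: h; exact: diff_eps.
Unshelve. all: by end_near. Qed.

Lemma differentiable_mxP V m n (f : V -> 'M[R]_(m, n)) p :
  differentiable f p <-> forall i j, differentiable (fun x => f x i j : R) p.
Proof.
split=> [df i j|df].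
  by apply: (differentiable_comp (g := fun N : 'M[R]_(m, n) => N i j : R) df);
    exact: differentiable_coord.
have -> : f = fun x => \sum_(i < m) \sum_(j < n) f x i j *: delta_mx i j.
  by apply/funext => x; exact: matrix_sum_delta.
have S q (g : 'I_q -> V -> 'M[R]_(m, n)) :
    (forall i, differentiable (g i) p) ->
    differentiable (fun x => \sum_(i < q) g i x) p.
  move=> dg; have := @differentiable_sum _ _ _ q g p dg.
  by congr (differentiable _ p); apply/funext => x; rewrite fct_sumE.
apply: (S m (fun i x => \sum_(j < n) f x i j *: delta_mx i j)) => i.
apply: (S n (fun j x => f x i j *: delta_mx i j)) => j.
by apply: differentiableZl; exact: df.
Qed.

Lemma derive_mx_coord V m n (f : V -> 'M[R]_(m, n)) p v i j :
  derivable f p v -> ('D_v f p) i j = 'D_v (fun x => f x i j) p.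
Proof. by move=> /derive_mx ->; rewrite mxE. Qed.

Lemma derive_comp_rV V W n (f : V -> 'rV[R]_n) (g : 'rV[R]_n -> W) p v :
  differentiable f p -> differentiable g (f p) ->
  'D_v (g \o f) p = \sum_(i < n) ('D_v f p) 0 i *: 'D_(delta_mx 0 i) g (f p).
Proof.
move=> df dg; rewrite deriveE; last exact: differentiable_comp.
rewrite diff_comp //= -(deriveE v df).
rewrite [in LHS](row_sum_delta ('D_v f p)) linear_sum.
by apply: eq_bigr => i _; rewrite linearZ (deriveE _ dg).
Qed.
End Differentiation.

(** * Calculus of smooth maps *)

Section SmoothCalculus.
Context {R : realType}.
Implicit Types V W : normedModType R.

(** [ndiff n D f]: f is n + 1 times differentiable on D.  The recursion peels
off the innermost directional derivative, so that closure properties of smooth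
maps are proved by induction on n. *)
Fixpoint ndiff V W (n : nat) (D : set V) (f : V -> W) : Prop :=
  (forall p, D p -> differentiable f p) /\
  (if n is m.+1 then forall v, ndiff m D ('D_v f) else True).

Lemma ndiff_differentiable V W n (D : set V) (f : V -> W) p :
  ndiff n D f -> D p -> differentiable f p.
Proof. by case: n => [|n] [df _]; exact: df. Qed.

Lemma ndiffW V W n (D : set V) (f : V -> W) : ndiff n.+1 D f -> ndiff n D f.
Proof.
elim: n f => [|n IH] f [df Df]; first by split.
by split => // v; exact: IH.
Qed.

Lemma smooth_onP V W (D : set V) (f : V -> W) :
  smooth_on D f <-> forall n, ndiff n D f.
Proof.
have smooth_derive (g : V -> W) v : smooth_on D g -> smooth_on D ('D_v g).
  by move=> sg s p Dp; have := sg (rcons s v) p Dp; rewrite foldr_rcons.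
split=> [sf n|nf s].
  elim: n f sf => [|n IH] f sf; first by split=> [p Dp|//]; exact: (sf [::]).
  by split=> [p Dp|v]; [exact: (sf [::])|exact/IH/smooth_derive].
elim/last_ind: s f nf => [|s v IH] f nf p Dp.
  exact: ndiff_differentiable (nf 0) Dp.
by rewrite foldr_rcons; apply: IH => // n; have [_] := nf n.+1; apply.
Qed.

Lemma ndiff_subset V W n (D E : set V) (f : V -> W) :
  E `<=` D -> ndiff n D f -> ndiff n E f.
Proof.
move=> ED; elim: n f => [|n IH] f [df Df]; split=> //.
- by move=> p /ED; exact: df.
- by move=> p /ED; exact: df.
- by move=> v; exact: IH (Df v).
Qed.

Section OpenDomain.
Context {V : normedModType R} (D : set V) (oD : open D).

(** Openness of the domain is what makes the derivatives of f depend only on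
the values of f on D. *)
Lemma eq_ndiff W n (f g : V -> W) :
  (forall p, D p -> f p = g p) -> ndiff n D f -> ndiff n D g.
Proof.
have nearD p : D p -> \forall x \near p, D x.
  by move=> Dp; exact: open_nbhs_nbhs (conj oD Dp).
elim: n f g => [|n IH] f g fg [df Df]; split=> //.
- move=> p Dp; apply: near_eq_differentiable (df p Dp).
  by apply: filterS (nearD p Dp) => x; exact: fg.
- move=> p Dp; apply: near_eq_differentiable (df p Dp).
  by apply: filterS (nearD p Dp) => x; exact: fg.
- move=> v; apply: IH (Df v) => p Dp; apply: near_eq_derive.
  by apply: filterS (nearD p Dp) => x; exact: fg.
Qed.

Lemma ndiff_cst W n (a : W) : ndiff n D (cst a).
Proof.
elim: n a => [|n IH] a; split=> // v.
by apply: eq_ndiff (IH 0) => p Dp /=; rewrite derive_cst.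
Qed.

Lemma ndiffD W n (f g : V -> W) :
  ndiff n D f -> ndiff n D g -> ndiff n D (fun x => f x + g x).
Proof.
elim: n f g => [|n IH] f g [df Df] [dg Dg]; split=> //.
- by move=> p Dp; apply: differentiableD; [exact: df|exact: dg].
- by move=> p Dp; apply: differentiableD; [exact: df|exact: dg].
- move=> v; apply: eq_ndiff (IH _ _ (Df v) (Dg v)) => p Dp.
  by rewrite deriveD //; apply: diff_derivable; [exact: df|exact: dg].
Qed.

Lemma ndiffN W n (f : V -> W) : ndiff n D f -> ndiff n D (fun x => - f x).
Proof.
elim: n f => [|n IH] f [df Df]; split=> //.
- by move=> p Dp; apply: differentiableN; exact: df.
- by move=> p Dp; apply: differentiableN; exact: df.
- move=> v; apply: eq_ndiff (IH _ (Df v)) => p Dp.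
  by rewrite deriveN //; apply: diff_derivable; exact: df.
Qed.

Lemma ndiffB W n (f g : V -> W) :
  ndiff n D f -> ndiff n D g -> ndiff n D (fun x => f x - g x).
Proof. by move=> nf ng; apply: ndiffD => //; exact: ndiffN. Qed.

Lemma ndiffM n (f g : V -> R) :
  ndiff n D f -> ndiff n D g -> ndiff n D (fun x => f x * g x).
Proof.
elim: n f g => [|n IH] f g nf ng; have [df Df] := nf; have [dg Dg] := ng;
  split=> //.
- by move=> p Dp; apply: differentiableM; [exact: df|exact: dg].
- by move=> p Dp; apply: differentiableM; [exact: df|exact: dg].
- move=> v; have nf' := ndiffW nf; have ng' := ndiffW ng.
  apply: eq_ndiff (ndiffD (IH _ _ nf' (Dg v)) (IH _ _ ng' (Df v))) => p Dp.
  by rewrite deriveM //; apply: diff_derivable; [exact: df|exact: dg].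
Qed.

Lemma ndiff_sum W n I (r : seq I) (P : pred I) (f : I -> V -> W) :
  (forall i, P i -> ndiff n D (f i)) ->
  ndiff n D (fun x => \sum_(i <- r | P i) f i x).
Proof.
move=> nf; elim: r => [|i r IH].
  by apply: eq_ndiff (ndiff_cst n (0 : W)) => x _; rewrite big_nil.
have [Pi|nPi] := boolP (P i).
  by apply: eq_ndiff (ndiffD (nf i Pi) IH) => x _; rewrite big_cons Pi.
by apply: eq_ndiff IH => x _; rewrite big_cons (negbTE nPi).
Qed.

Lemma ndiff_prod n I (r : seq I) (P : pred I) (f : I -> V -> R) :
  (forall i, P i -> ndiff n D (f i)) ->
  ndiff n D (fun x => \prod_(i <- r | P i) f i x).
Proof.
move=> nf; elim: r => [|i r IH].
  by apply: eq_ndiff (ndiff_cst n (1 : R)) => x _; rewrite big_nil.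
have [Pi|nPi] := boolP (P i).
  by apply: eq_ndiff (ndiffM (nf i Pi) IH) => x _; rewrite big_cons Pi.
by apply: eq_ndiff IH => x _; rewrite big_cons (negbTE nPi).
Qed.

Lemma ndiffV n (f : V -> R) :
  (forall p, D p -> f p != 0) -> ndiff n D f ->
  ndiff n D (fun x => (f x)^-1).
Proof.
move=> f0; elim: n f f0 => [|n IH] f f0 nf; have [df Df] := nf; split=> //.
- by move=> p Dp; apply: differentiableV; [exact: df|exact: f0].
- by move=> p Dp; apply: differentiableV; [exact: df|exact: f0].
- move=> v; have nf' := IH _ f0 (ndiffW nf).
  have := ndiffM (ndiff_cst n (-1 : R)) (ndiffM (ndiffM nf' nf') (Df v)).
  apply: eq_ndiff => p Dp /=.
  rewrite deriveV; [|exact: f0|by apply: diff_derivable; exact: df].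
  by rewrite mulN1r -expr2 exprVn /GRing.scale /= mulNr.
Qed.

Lemma ndiff_mxP n k l (f : V -> 'M[R]_(k, l)) :
  ndiff n D f <-> forall i j, ndiff n D (fun x => f x i j : R).
Proof.
elim: n f => [|n IH] f; split.
- by move=> [df _] i j; split=> // p /df/differentiable_mxP; exact.
- by move=> df; split=> // p Dp; apply/differentiable_mxP => i j;
    have [+ _] := df i j; exact.
- move=> [df Df] i j; split=> [p /df/differentiable_mxP|v]; first exact.
  have /IH/(_ i j) := Df v; apply: eq_ndiff => p Dp.
  by rewrite derive_mx_coord //; apply: diff_derivable; exact: df.
- move=> df.
  have dfD p : D p -> differentiable f p.
    by move=> Dp; apply/differentiable_mxP => i j; have [+ _] := df i j; exact.
  split=> // v; apply/IH => i j; have [_ /(_ v)] := df i j.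
  apply: eq_ndiff => p Dp.
  by rewrite derive_mx_coord //; apply: diff_derivable; exact: dfD.
Qed.

End OpenDomain.

(** The chain rule in coordinates, D_v (g o f) = sum_i (D_v f)_i (D_i g) o f,
expresses a derivative of a composite by composites of the same kind. *)
Lemma ndiff_comp_real V m n (D : set V) (E : set 'rV[R]_m)
    (f : V -> 'rV[R]_m) (g : 'rV[R]_m -> R) :
  open D -> (forall p, D p -> E (f p)) ->
  ndiff n D f -> ndiff n E g -> ndiff n D (g \o f).
Proof.
move=> oD DE; elim: n f g DE => [|n IH] f g DE nf ng;
  have [df Df] := nf; have [dg Dg] := ng; split=> //.
- by move=> p Dp; apply: differentiable_comp; [exact: df|exact/dg/DE].
- by move=> p Dp; apply: differentiable_comp; [exact: df|exact/dg/DE].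
- move=> v.
  apply: (eq_ndiff oD (f := fun x => \sum_(i < m)
    (('D_v f x) 0 i * ('D_(delta_mx 0 i) g \o f) x))) => [p Dp|].
    by rewrite derive_comp_rV //; [exact: df|exact/dg/DE].
  apply: ndiff_sum => // i _.
  apply: ndiffM => //; first by have /(ndiff_mxP oD)/(_ 0 i) := Df v.
  exact: IH DE (ndiffW nf) (Dg _).
Qed.

Lemma ndiff_comp V m k l n (D : set V) (E : set 'rV[R]_m)
    (f : V -> 'rV[R]_m) (g : 'rV[R]_m -> 'M[R]_(k, l)) :
  open D -> open E -> (forall p, D p -> E (f p)) ->
  ndiff n D f -> ndiff n E g -> ndiff n D (g \o f).
Proof.
move=> oD oE DE nf /(ndiff_mxP oE) ng; apply/(ndiff_mxP oD) => i j.
exact: (ndiff_comp_real oD DE nf (ng i j)).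
Qed.

End SmoothCalculus.

(** * Mean value estimates *)

Section MeanValue.
Context {R : realType}.

Lemma is_derive_line (V W : normedModType R) (f : V -> W) (a v : V) (t : R) :
  derivable f (a + t *: v) v ->
  is_derive t 1 (fun s : R => f (a + s *: v)) ('D_v f (a + t *: v)).
Proof.
set g := fun s : R => _.
have E : (fun h : R => h^-1 *: ((g \o shift t) (h *: (1 : R)) - g t)) =
         (fun h => h^-1 *: ((f \o shift (a + t *: v)) (h *: v)
                            - f (a + t *: v))).
  apply/funext => h; rewrite /g /=; congr (_ *: (f _ - _)).
  by rewrite [h%:A]mulr1 scalerDl addrCA.
by move=> df; split; rewrite /derivable /derive E.
Qed.

Lemma ball_segment (V : normedModType R) (p a b : V) (r t : R) :
  0 <= t <= 1 -> ball p r a -> ball p r b -> ball p r (a + t *: (b - a)).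
Proof.
move=> /andP[t0 t1]; rewrite -!ball_normE /= => pa pb.
have -> : p - (a + t *: (b - a)) = (1 - t) *: (p - a) + t *: (p - b).
  rewrite opprD addrA scalerBl scale1r -[RHS]addrA; congr (_ + _).
  by rewrite -!scalerN -scalerDr !opprB addrA subrK.
apply: le_lt_trans (ler_normD _ _) _; rewrite !normrZ.
rewrite !ger0_norm ?subr_ge0 //.
have [->|t_neq1] := eqVneq t 1; first by rewrite subrr mul0r add0r mul1r.
have t_lt1 : 0 < 1 - t by rewrite subr_gt0 lt_neqAle t_neq1.
have := ltr_pM2l t_lt1 `|p - a| r; rewrite pa => H1.
have := ler_wpM2l t0 (ltW pb) => H2.
have -> : r = (1 - t) * r + t * r by ring.
by apply: ltr_leD.
Qed.

Lemma mean_value_ball (V : normedModType R) (f : V -> R) (p a b : V) (r : R) :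
  (forall x, ball p r x -> differentiable f x) ->
  ball p r a -> ball p r b ->
  exists2 c, ball p r c & f b - f a = 'D_(b - a) f c.
Proof.
move=> df pa pb.
pose g (s : R) := f (a + s *: (b - a)).
have pseg (t : R) : t \in `[0, 1]%R -> ball p r (a + t *: (b - a)).
  by rewrite in_itv /= => t01; exact: ball_segment.
have dg (t : R) : t \in `[0, 1]%R ->
    is_derive t 1 g ('D_(b - a) f (a + t *: (b - a))).
  by move=> /pseg ?; apply/is_derive_line/diff_derivable/df.
have dg' (t : R) : t \in `]0, 1[%R ->
    is_derive t 1 g ('D_(b - a) f (a + t *: (b - a))).
  by move=> /subset_itv_oo_cc; exact: dg.
have cg : {within `[0, 1], continuous g}.
  by apply: derivable_within_continuous => t /dg [].
have [c c01] := MVT ltr01 dg' cg.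
rewrite subr0 mulr1 /g scale1r scale0r addr0 subrKC => E.
by exists (a + c *: (b - a)) => //; apply: pseg; exact: subset_itv_oo_cc.
Qed.

Lemma derive0_ball_cst (V : normedModType R) (f : V -> R) (p : V) (r : R) :
  (forall x, ball p r x -> differentiable f x /\ forall v, 'D_v f x = 0) ->
  forall x, ball p r x -> f x = f p.
Proof.
move=> df x px.
have pp : ball p r p.
  by move: px; rewrite -!ball_normE /= subrr normr0; apply: le_lt_trans.
have [|c /df[_ ->]] := mean_value_ball (f := f) _ pp px; last first.
  by move=> /eqP; rewrite subr_eq0 => /eqP.
by move=> y /df[].
Qed.
End MeanValue.

Section RowNorm.
Context {R : realType}.

Lemma ler_coord_norm m n (M : 'M[R]_(m, n)) i j : `|M i j| <= `|M|.
Proof.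
by rewrite [leRHS]/Num.Def.normr /= mx_normrE; exact: (le_bigmax _ _ (i, j)).
Qed.

Lemma ler_mx_norm m n (M : 'M[R]_(m, n)) (c : R) :
  0 <= c -> (forall i j, `|M i j| <= c) -> `|M| <= c.
Proof.
move=> c0 Mc; rewrite [leLHS]/Num.Def.normr /= mx_normrE.
by apply/bigmax_leP; split=> // -[i j] _; exact: Mc.
Qed.

Lemma mulmxr_lipschitz m n k (A : 'M[R]_(n, k)) :
  exists2 c, 0 < c & forall v : 'M[R]_(m, n), `|v *m A| <= c * `|v|.
Proof.
pose c : R := \sum_j \sum_i `|A i j|.
have c0 : 0 <= c by apply: sumr_ge0 => j _; exact: sumr_ge0.
exists (c + 1) => [|v]; first by rewrite ltr_wpDl.
apply: ler_mx_norm => [|i j]; first by rewrite mulr_ge0 // addr_ge0.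
have colj : \sum_l `|A l j| <= c + 1.
  rewrite /c (bigD1 j) //= -addrA lerDl addr_ge0 //.
  by apply: sumr_ge0 => l _; exact: sumr_ge0.
apply: le_trans (ler_wpM2r (normr_ge0 v) colj).
rewrite mxE (le_trans (ler_norm_sum _ _ _)) // mulr_suml.
by apply: ler_sum => l _; rewrite normrM mulrC ler_wpM2l ?ler_coord_norm.
Qed.

Lemma mulmxr_continuous n k (A : 'M[R]_(n, k)) :
  continuous (mulmxr A : 'rV[R]_n -> 'rV[R]_k).
Proof.
have [c c0 cA] := mulmxr_lipschitz 1 A.
apply: (@bounded_linear_continuous _ _ _ (mulmxr A)).
apply/(bounded_funP (mulmxr A)) => r; exists (c * r) => v vr.
by rewrite (le_trans (cA v)) // ler_pM2l.
Qed.
End RowNorm.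

(** * The inverse function theorem *)

Section SmoothMatrix.
Context {R : realType} {V : normedModType R} (D : set V) (oD : open D).

Lemma ndiff_det n q (M : V -> 'M[R]_q) :
  ndiff n D M -> ndiff n D (fun x => \det (M x)).
Proof.
move=> /(ndiff_mxP oD) nM; apply: ndiff_sum => // s _.
apply: ndiffM => //; first exact: ndiff_cst.
exact: ndiff_prod.
Qed.

(** Cramer's rule: the entries of the inverse are rational functions of the
entries. *)
Lemma ndiff_invmx n q (M : V -> 'M[R]_q) :
  (forall x, D x -> M x \in unitmx) ->
  ndiff n D M -> ndiff n D (fun x => invmx (M x)).
Proof.
move=> uM nM; apply/(ndiff_mxP oD) => i j.
have nMij := (ndiff_mxP oD n M).1 nM.
apply: (eq_ndiff oD (f := fun x => (\det (M x))^-1 *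
    ((-1) ^+ (j + i) * \det (row' j (col' i (M x)))))) => [x Dx|].
  by rewrite /invmx uM // !mxE.
apply: ndiffM => //.
  apply: ndiffV => //; last exact: ndiff_det.
  by move=> x /uM; rewrite unitmxE unitfE.
apply: ndiffM => //; first exact: ndiff_cst.
apply: ndiff_det; apply/(ndiff_mxP oD) => a b.
by apply: (eq_ndiff oD) (nMij (lift j a) (lift i b)) => x _; rewrite !mxE.
Qed.
End SmoothMatrix.

(** Row vectors over R form a complete normed module, the setting of Banach's
fixed point theorem. *)
HB.instance Definition _ (R : realType) (n : nat) :=
  Uniform_isComplete.Build 'rV[R]_n (@mx_complete R 1 n).

Section InverseFunction.
Context {R : realType} {n : nat}.
Local Notation E := 'rV[R]_n.

Lemma jacobianE m k (f : 'rV[R]_m -> 'rV[R]_k) p i j :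
  differentiable f p -> 'J f p i j = ('D_(delta_mx 0 i) f p) 0 j.
Proof. by move=> df; rewrite mxE deriveE. Qed.

Lemma ndiff_jacobian m k l (D : set 'rV[R]_m) (f : 'rV[R]_m -> 'rV[R]_k) :
  open D -> ndiff l.+1 D f -> ndiff l D (fun p => 'J f p).
Proof.
move=> oD [df Df]; apply/(ndiff_mxP oD) => i j.
have /(ndiff_mxP oD)/(_ 0 j) := Df (delta_mx 0 i).
by apply: (eq_ndiff oD) => p Dp; rewrite jacobianE //; exact: df.
Qed.

(** By continuity the partial derivatives of g are small near p; the mean
value theorem turns this into a Lipschitz bound. *)
Lemma small_derivative_lipschitz (D : set E) (g : E -> E) (p : E) :
  open D -> ndiff 1 D g -> D p -> 'J g p = 0 ->
  exists2 d, 0 < d & ball p d `<=` D /\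
    forall a b, ball p d a -> ball p d b -> `|g b - g a| <= 2^-1 * `|b - a|.
Proof.
move=> oD ng Dp Jp0.
(* n partial derivatives of size at most e give a Lipschitz constant n e <= 1/2;
   the successor keeps e meaningful when n = 0 *)
pose e : R := (2 * n.+1%:R)^-1.
have e0 : 0 < e by rewrite invr_gt0 mulr_gt0.
have nD : \forall x \near p, D x by exact: open_nbhs_nbhs (conj oD Dp).
have nJ : \forall x \near p, forall ij : 'I_n * 'I_n, `|'J g x ij.1 ij.2| <= e.
  apply: (filter_forall (nbhs_filter p)) => -[i j] /=.
  have nJij : ndiff 0 D (fun x => 'J g x i j).
    by have /(ndiff_mxP oD) := ndiff_jacobian oD ng.
  have cJ := differentiable_continuous (ndiff_differentiable nJij Dp).
  have := (cvgrPdist_le (FF := nbhs_filter p) _ _).1 cJ e e0.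
  by apply: filterS => x /=; rewrite Jp0 mxE sub0r normrN.
have [d /= d0 dP] := (nbhs_ballP p _).1 (filterI nD nJ).
exists d => //; split=> [x /dP[]//|a b pa pb].
apply: ler_mx_norm => [|i j]; first by rewrite mulr_ge0.
rewrite ord1 {i}.
have dg x : ball p d x -> differentiable g x.
  by move=> /dP[Dx _]; exact: ndiff_differentiable ng Dx.
have dgj x : ball p d x -> differentiable (fun y => g y 0 j : R) x.
  by move=> /dg/differentiable_mxP; exact.
have [c pc] := mean_value_ball dgj pa pb.
rewrite !mxE => ->.
rewrite -(derive_mx_coord 0 j); last exact/diff_derivable/dg.
rewrite deriveEjacobian; last exact: dg.
rewrite mxE (le_trans (ler_norm_sum _ _ _)) //.
apply: (@le_trans _ _ (\sum_(i < n) `|b - a| * e)).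
  apply: ler_sum => i _; rewrite normrM ler_pM ?ler_coord_norm //.
  by have [_ /(_ (i, j))] := dP c pc.
rewrite sumr_const card_ord -[_ *+ n]mulr_natr -mulrA mulrC ler_wpM2r //.
rewrite /e invfM -mulrA ler_piMr // mulrC ler_pdivrMr // mul1r ler_nat.
exact: leqnSn.
Qed.

(** The equation x + g x = q says that x is a fixed point of the contraction
x |-> q - g x, which preserves the closed ball of radius r around p. *)
Lemma perturbed_identity_onto (g : E -> E) (p : E) (r : R) :
  (forall a b, `|p - a| <= r -> `|p - b| <= r ->
     `|g b - g a| <= 2^-1 * `|b - a|) ->
  forall q, `|q - (p + g p)| <= 2^-1 * r ->
  exists2 x, `|p - x| <= r & x + g x = q.
Proof.
move=> gl q qp; pose B : set E := [set x | `|p - x| <= r].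
have r0 : 0 <= r.
  have := le_trans (normr_ge0 _) qp.
  by rewrite pmulr_rge0 ?invr_gt0.
have pp : B p by rewrite /B /= subrr normr0.
pose T x := q - g x.
have TT : {homo T : x / B x >-> B x}.
  move=> x px; rewrite /B /=.
  have -> : p - T x = (g x - g p) - (q - (p + g p)).
    by apply/rowP => i; rewrite /T !mxE; ring.
  rewrite (le_trans (ler_normB _ _)) // (splitr r) lerD //; last first.
    by rewrite mulrC.
  by rewrite (le_trans (gl _ _ pp px)) // mulrC distrC ler_wpM2r.
have ctr : is_contraction (mkfun_fun TT).
  exists (2^-1)%:nng; split => /=; first by rewrite invf_lt1 // ltr1n.
  move=> [a b] [/= pa pb]; rewrite /mkfun.
  have -> : T a - T b = g b - g a by apply/rowP => i; rewrite /T !mxE; ring.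
  by rewrite [in leRHS]distrC; exact: gl.
have clB : closed B by exact: closed_closed_ball_.
have [|x px xE] := banach_fixed_point ctr clB; first by exists p.
by exists x => //; rewrite {1}xE /= /mkfun /T subrK.
Qed.
End InverseFunction.

Section LinearSmooth.
Context {R : realType} {V W X : normedModType R}.

Lemma derive_linear (L : {linear W -> X}) (f : V -> W) p v :
  continuous L -> differentiable f p -> 'D_v (L \o f) p = L ('D_v f p).
Proof.
move=> cL df; have dL : differentiable L (f p) by exact: linear_differentiable.
rewrite deriveE; last exact: differentiable_comp.
by rewrite diff_comp //= diff_lin // -deriveE.
Qed.

Lemma ndiff_linear_comp (D : set V) (L : {linear W -> X}) (f : V -> W) n :
  open D -> continuous L -> ndiff n D f -> ndiff n D (L \o f).
Proof.
move=> oD cL; elim: n f => [|n IH] f [df Df]; split=> //.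
- move=> p /df ?; apply: differentiable_comp => //.
  exact: linear_differentiable.
- move=> p /df ?; apply: differentiable_comp => //.
  exact: linear_differentiable.
- move=> v; apply: (eq_ndiff oD) (IH _ (Df v)) => p Dp /=.
  by rewrite derive_linear //; exact: df.
Qed.

Lemma ndiff_id (D : set V) n : open D -> ndiff n D (id : V -> V).
Proof.
move=> oD; case: n => [|n]; split=> // v.
by apply: (eq_ndiff oD) (ndiff_cst oD n v) => p Dp; rewrite derive_id.
Qed.
End LinearSmooth.

Section InverseFunctionTheorem.
Context {R : realType} {n : nat}.
Local Notation E := 'rV[R]_n.

(** A Lipschitz right inverse F of Phi is differentiable: with
u = F (k + q) - F q and J the Jacobian of Phi at F q, the remainder
u - k J^-1 = - (k - u J) J^-1 is o(u), hence o(k). *)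
Lemma inverse_derivative (Phi F : E -> E) (q : E) (c : R) :
  differentiable Phi (F q) -> 'J Phi (F q) \in unitmx -> 0 < c ->
  (\forall k \near (0 : E), Phi (F (k + q)) = k + q) -> Phi (F q) = q ->
  (\forall k \near (0 : E), `|F (k + q) - F q| <= c * `|k|) ->
  is_diff q F (mulmxr (invmx ('J Phi (F q)))).
Proof.
move=> dPhi uJ c0 PhiF PhiFq Flip.
set B := invmx _; set x := F q.
have [c' c'0 cB] := mulmxr_lipschitz 1 B.
apply: is_diff_eps => [|e e0]; first exact: mulmxr_continuous.
have e'0 : 0 < e / (c' * c) by rewrite divr_gt0 // mulr_gt0.
have /(nbhs_ballP (0 : E) _).1 [d /= d0 dP] := diff_eps dPhi e'0.
have nd : \forall k \near (0 : E), `|k| < d / c.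
  apply/(nbhs_ballP (0 : E)); exists (d / c) => /=; first exact: divr_gt0.
  by move=> k; rewrite -ball_normE /= sub0r normrN.
near=> k.
have uk : `|F (k + q) - x| <= c * `|k| by near: k.
set u := F (k + q) - x in uk *.
have ud : ball (0 : E) d u.
  rewrite -ball_normE /= sub0r normrN (le_lt_trans uk) // mulrC.
  by rewrite -ltr_pdivlMr //; near: k.
have Pu : Phi (u + x) = k + q by rewrite /u subrK; near: k.
have := dP u ud.
rewrite /= -deriveE // deriveEjacobian // PhiFq Pu addrK => Hu.
have -> : u - mulmxr B k = - ((k - u *m 'J Phi x) *m B).
  by rewrite mulmxBl mulmxK // opprB.
rewrite normrN (le_trans (cB _)) //.
apply: (@le_trans _ _ (c' * (e / (c' * c) * (c * `|k|)))).
  by rewrite ler_pM2l // (le_trans Hu) // ler_pM2l.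
rewrite le_eqVlt; apply/orP; left; apply/eqP.
by field; rewrite !gt_eqF.
Unshelve. all: by end_near. Qed.

(** After composing with the inverse of the Jacobian at p, Phi is the identity
plus a 1/2-Lipschitz map g near p.  Contraction gives an inverse F, the
Lipschitz bound makes F injective, continuous and differentiable, and the
formula DF = (J Phi)^-1 o F bootstraps the smoothness of F.  The domain of F
is a ball for the sup norm, that is, a cube. *)
Theorem inverse_function (D : set E) (Phi : E -> E) (p : E) :
  open D -> smooth_on D Phi -> D p -> 'J Phi p \in unitmx ->
  exists (V : set E) (F : E -> E) (e : R),
  [/\ [/\ open V, V p & V `<=` D], 0 < e,
      smooth_on (ball (Phi p) e) F,
      forall q, ball (Phi p) e q -> V (F q) /\ Phi (F q) = q &
      forall x, V x -> ball (Phi p) e (Phi x) /\ F (Phi x) = x].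
Proof.
move=> oD /smooth_onP nPhi Dp uJp.
set A := invmx ('J Phi p).
pose g x := Phi x *m A - x.
have ng D' : open D' -> D' `<=` D -> ndiff 1 D' g.
  move=> oD' D'D; have nPhi' := ndiff_subset D'D (nPhi 1).
  have nL := ndiff_linear_comp oD' (mulmxr_continuous (A := A)) nPhi'.
  exact: (ndiffB oD' nL (ndiff_id 1 oD')).
have dPhi x : D x -> differentiable Phi x.
  exact: ndiff_differentiable (nPhi 0).
have Jg : 'J g p = 0.
  have ng0 := ng D oD (@subset_refl _ D).
  have dg := ndiff_differentiable ng0 Dp.
  apply/matrixP => i j; rewrite jacobianE //.
  have dL : differentiable (mulmxr A \o Phi) p.
    apply: differentiable_comp; first exact: dPhi.
    by apply: linear_differentiable; exact: mulmxr_continuous.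
  rewrite [g](_ : _ = (mulmxr A \o Phi) - id); last by [].
  rewrite deriveB; [|exact: diff_derivable|exact: diff_derivable].
  rewrite (derive_linear _ (mulmxr_continuous (A := A))); last exact: dPhi.
  rewrite derive_id.
  by rewrite (deriveEjacobian _ (dPhi p Dp)) /= mulmxK // subrr !mxE.
have [d0 d0_gt0 d0P] : exists2 d, 0 < d &
    forall x, ball p d x -> D x /\ 'J Phi x \in unitmx.
  have nD : \forall x \near p, D x by exact: open_nbhs_nbhs (conj oD Dp).
  have ndet : ndiff 0 D (fun x => \det ('J Phi x)).
    by apply: ndiff_det => //; apply: ndiff_jacobian.
  have cdet := differentiable_continuous (ndiff_differentiable ndet Dp).
  have det0 : \det ('J Phi p) != 0 by rewrite -unitfE -unitmxE.
  have nU : \forall x \near p, \det ('J Phi x) != 0.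
    exact: (cvgr_neq0 (FF := nbhs_filter p) _ cdet det0).
  have [d /= d_gt0 dP] := (nbhs_ballP p _).1 (filterI nD nU).
  exists d; first exact: d_gt0.
  move=> x px; have [Dx Ux] := dP x px.
  by split; [exact: Dx|rewrite unitmxE unitfE; exact: Ux].
have oB0 : open (ball p d0) by exact: ball_open.
have [|d d_gt0 [dd0 gl]] :=
    small_derivative_lipschitz oB0 (ng _ oB0 _) (ballxx p d0_gt0) Jg.
  by move=> x /d0P[].
have dD x : ball p d x -> D x /\ 'J Phi x \in unitmx by move=> /dd0/d0P.
have [c c_gt0 cA] := mulmxr_lipschitz 1 A.
pose r := d / 2; have r0 : 0 < r by rewrite divr_gt0.
have rd x : `|p - x| <= r -> ball p d x.
  rewrite -ball_normE /= => /le_lt_trans; apply.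
  by rewrite /r ltr_pdivrMr // ltr_pMr // ltr1n.
pose e := r / (2 * c); have e0 : 0 < e by rewrite divr_gt0 // mulr_gt0.
have onto q : exists x, ball (Phi p) e q -> `|p - x| <= r /\ Phi x = q.
  have [Bq|] := pselect (ball (Phi p) e q); last by exists q.
  have [||x px xq] := @perturbed_identity_onto _ _ g p r _ (q *m A).
  - by move=> a b /rd pa /rd pb; exact: gl.
  - rewrite /g subrKC -mulmxBl (le_trans (cA _)) //.
    move: Bq; rewrite -ball_normE /= distrC => /ltW.
    rewrite /e ler_pdivlMr ?mulr_gt0 // => H.
    by rewrite ler_pdivlMl // mulrA [_ * `|_|]mulrC.
  have uA : A \in unitmx by rewrite unitmx_inv.
  exists x => _; split=> //; move: xq; rewrite /g subrKC => xq.
  by rewrite -(mulmxK uA (Phi x)) xq mulmxK.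
have [F FP] := choice onto.
have inj a b : ball p d a -> ball p d b ->
    `|b - a| <= (2 * c) * `|Phi b - Phi a|.
  move=> pa pb; have := gl a b pa pb.
  have E1 : b - a = (Phi b - Phi a) *m A - (g b - g a).
    by rewrite /g mulmxBl; apply/rowP => i; rewrite !mxE; ring.
  have := ler_normB ((Phi b - Phi a) *m A) (g b - g a); rewrite -E1.
  by have := cA (Phi b - Phi a); lra.
pose B := ball (Phi p) e.
have FB q : B q -> ball p d (F q) /\ Phi (F q) = q.
  by move=> /FP[/rd]; split.
have oB : open B by exact: ball_open.
pose V := ball p d `&` Phi @^-1` B.
exists V, F, e; split=> //.
- split.
  + rewrite openE => x [px Bx]; apply: filterI.
      by apply: open_nbhs_nbhs; split=> //; exact: ball_open.
    have cPhi := differentiable_continuous (dPhi x (dD x px).1).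
    by apply: cPhi; apply: open_nbhs_nbhs.
  + by split; exact: ballxx.
  + by move=> x [/dD[]].
- apply/smooth_onP.
  have dF q : B q -> is_diff q F (mulmxr (invmx ('J Phi (F q)))).
    move=> Bq; have [pF PF] := FB q Bq; have [DF uF] := dD _ pF.
    have nB : \forall k \near (0 : E), B (k + q).
      have : \forall x \near q, B x by exact: open_nbhs_nbhs.
      by rewrite (near_shift (0 : E)) subr0.
    apply: (@inverse_derivative _ _ _ (2 * c)) => //.
    + exact: dPhi.
    + by rewrite mulr_gt0.
    + by near=> k; have [|_] := FB (k + q); first by near: k.
    + near=> k; have [|pk Pk] := FB (k + q); first by near: k.
      by have := inj _ _ pF pk; rewrite Pk PF addrK.
  elim=> [|l IH]; first by split=> // q /dF[].
  split=> [q /dF[] //|v].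
  have oBd : open (ball p d) by exact: ball_open.
  have nInv : ndiff l (ball p d) (fun x => invmx ('J Phi x)).
    apply: (ndiff_invmx oBd) => [x px|]; first by have [_] := dD x px.
    apply: (ndiff_jacobian oBd); apply: ndiff_subset (nPhi l.+1) => x px.
    by have [] := dD x px.
  have nvInv : ndiff l (ball p d) (fun x => v *m invmx ('J Phi x)).
    apply/(ndiff_mxP oBd) => i j.
    apply: (eq_ndiff oBd
      (f := fun x => \sum_k v i k * invmx ('J Phi x) k j)) => [x _|].
      by rewrite mxE.
    apply: ndiff_sum => // k _; apply: ndiffM => //; first exact: ndiff_cst.
    by have /(ndiff_mxP oBd) := nInv.
  have := ndiff_comp oB oBd (fun q Bq => (FB q Bq).1) IH nvInv.
  apply: (eq_ndiff oB) => q Bq /=.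
  by have dFq := dF q Bq; rewrite deriveE // diff_val.
- by move=> q Bq; have [pF PF] := FB q Bq; split=> //; split=> //=; rewrite PF.
- move=> x [px Bx]; split=> //; have [pF PF] := FB _ Bx.
  have := inj _ _ px pF; rewrite PF subrr normr0 mulr0 normr_le0 subr_eq0.
  by move=> /eqP.
Unshelve. all: by end_near. Qed.
End InverseFunctionTheorem.

(** * Primitives given by oriented integrals *)

Section OrientedIntegral.
Context {R : realType}.
Notation mu := (@lebesgue_measure R).

Lemma oriented_integralE (f : R -> R) (a b c t : R) :
  {within `[a, b], continuous f} -> a <= c <= b -> a <= t <= b ->
  oriented_integral c t f =
  \int[mu]_(s in `[a, t]) f s - \int[mu]_(s in `[a, c]) f s.
Proof.
move=> cf /andP[ac cb] /andP[at_ tb].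
have intf : mu.-integrable `[a, b] (EFin \o f).
  by apply: continuous_compact_integrable => //; exact: segment_compact.
have sub x y : a <= x -> y <= b -> mu.-integrable `[x, y] (EFin \o f).
  move=> ax yb; apply: integrableS intf => //.
  by apply: subset_itv; rewrite bnd_simp.
have key x y : a <= x -> x <= y -> y <= b ->
    \int[mu]_(s in `[a, y]) f s - \int[mu]_(s in `[a, x]) f s =
    \int[mu]_(s in `[x, y]) f s.
  move=> ax xy yb; rewrite Rintegral_itvB ?bnd_simp //; last exact: sub.
  rewrite Rintegral_itv_obnd_cbnd //.
  apply: integrableS (sub x y ax yb) => //.
  by apply: subset_itv; rewrite bnd_simp.
rewrite /oriented_integral; case: ifPn => [ct|].
  by rewrite key.
by rewrite -ltNge => /ltW tc; rewrite -key // opprB.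
Qed.

(** Near x the oriented integral from c differs by a constant from the
integral from a fixed point a to the left of both c and x, where the
fundamental theorem of calculus applies. *)
Lemma is_derive_oriented_integral (I : set R) (f : R -> R) (c x : R) :
  open I -> is_interval I -> I c -> I x ->
  (forall y, I y -> {for y, continuous f}) ->
  is_derive x 1 (fun y => oriented_integral c y f) (f x).
Proof.
move=> oI itvI Ic Ix cf.
have [d d0 [Ica Icb Ixa Ixb]] : exists2 d : R, 0 < d &
    [/\ I (c - d), I (c + d), I (x - d) & I (x + d)].
  have nI y : I y -> exists2 e : R, 0 < e &
      forall d, 0 < d < e -> I (y - d) /\ I (y + d).
    move=> Iy; have /nbhs_ballP[e /= e0 eI] := open_nbhs_nbhs (conj oI Iy).
    exists e => // d /andP[d0 de]; split; apply: eI; rewrite -ball_normE /=.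
      by rewrite opprB addrC subrK gtr0_norm.
    by rewrite opprD addrA subrr sub0r normrN gtr0_norm.
  have [e e0 eI] := nI c Ic; have [e' e'0 e'I] := nI x Ix.
  pose d := Num.min e e' / 2.
  have m0 : 0 < Num.min e e' by rewrite lt_min e0 e'0.
  have dm : 0 < d < Num.min e e' by rewrite /d; apply/andP; split; lra.
  have /andP[d0] := dm; rewrite lt_min => /andP[de de'].
  have [|? ?] := eI d; first by rewrite d0.
  have [|? ?] := e'I d; first by rewrite d0.
  by exists d.
pose a := Num.min c x - d; pose b := Num.max c x + d.
have Ia : I a by rewrite /a; case: leP.
have Ib : I b by rewrite /b; case: leP.
have ac : a < c by rewrite /a ltrBlDr ltr_pwDr // ge_min lexx.
have ax : a < x by rewrite /a ltrBlDr ltr_pwDr // ge_min lexx orbT.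
have cb : c < b by rewrite /b ltr_pwDr // le_max lexx.
have xb : x < b by rewrite /b ltr_pwDr // le_max lexx orbT.
have Iab y : y \in `[a, b] -> I y.
  by rewrite in_itv /= => aby; apply: itvI aby.
have cab : {within `[a, b], continuous f}.
  by apply: continuous_in_subspaceT => y /[!inE] /Iab; exact: cf.
have intf : mu.-integrable `[a, b] (EFin \o f).
  by apply: continuous_compact_integrable => //; exact: segment_compact.
have [dG G'] := @continuous_FTC1_closed R f a x b xb intf ax (cf x Ix).
set G := fun y => \int[mu]_(t in `[a, y]) f t in dG G'.
have dGx : is_derive x 1 G (f x) by split; rewrite -?derive1E.
apply: (@near_eq_is_derive _ _ _ (fun y => G y - G c)).
  near=> y; apply/esym/(@oriented_integralE f a b) => //; first by rewrite !ltW.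
  by apply/andP; split; apply/ltW; near: y; [exact: lt_nbhsr|exact: lt_nbhsl].
by rewrite -[f x]subr0; apply: is_deriveB.
Unshelve. all: by end_near. Qed.
End OrientedIntegral.

(** * Euclidean geometry of three-space *)

Section DotProduct.
Context {R : realType}.
Implicit Types u v w : 'rV[R]_3.

Lemma dot_mulmx u v : dot u v = (u *m v^T) 0 0.
Proof. by rewrite mxE; apply: eq_bigr => i _; rewrite mxE. Qed.

Lemma dotC u v : dot u v = dot v u.
Proof. by apply: eq_bigr => i _; rewrite mulrC. Qed.

Lemma dotDl u v w : dot (u + v) w = dot u w + dot v w.
Proof. by rewrite !dot_mulmx mulmxDl mxE. Qed.

Lemma dotZl a u v : dot (a *: u) v = a * dot u v.
Proof. by rewrite !dot_mulmx -scalemxAl mxE. Qed.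

Lemma dotNl u v : dot (- u) v = - dot u v.
Proof. by rewrite !dot_mulmx mulNmx mxE. Qed.

Lemma dotBl u v w : dot (u - v) w = dot u w - dot v w.
Proof. by rewrite dotDl dotNl. Qed.

Lemma dotDr u v w : dot u (v + w) = dot u v + dot u w.
Proof. by rewrite !(dotC u) dotDl. Qed.

Lemma dotZr a u v : dot u (a *: v) = a * dot u v.
Proof. by rewrite !(dotC u) dotZl. Qed.

Lemma dotNr u v : dot u (- v) = - dot u v.
Proof. by rewrite !(dotC u) dotNl. Qed.

Lemma dotBr u v w : dot u (v - w) = dot u v - dot u w.
Proof. by rewrite dotDr dotNr. Qed.

Lemma dot0l u : dot 0 u = 0.
Proof. by rewrite dot_mulmx mul0mx mxE. Qed.

Lemma dot0r u : dot u 0 = 0.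
Proof. by rewrite dotC dot0l. Qed.

Definition dot_expand :=
  (dotDl, dotDr, dotBl, dotBr, dotZl, dotZr, dotNl, dotNr, dot0l, dot0r).

Lemma dot_ge0 u : 0 <= dot u u.
Proof. by apply: sumr_ge0 => i _; rewrite -expr2 sqr_ge0. Qed.

Lemma dot_eq0 u : (dot u u == 0) = (u == 0).
Proof.
apply/eqP/eqP => [|->]; last by rewrite dot0l.
move=> /eqP; rewrite psumr_eq0 => [/allP u0|i _]; last first.
  by rewrite -expr2 sqr_ge0.
apply/rowP => i; rewrite mxE; apply/eqP.
by have := u0 i (mem_index_enum i); rewrite /= -expr2 sqrf_eq0.
Qed.

(** A 2 x 3 matrix has a nonzero kernel; normalize one of its vectors. *)
Lemma orthogonal_unit_exists u v : exists w,
  [/\ dot w w = 1, dot w u = 0 & dot w v = 0].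
Proof.
pose M := col_mx u v.
have : kermx M^T != 0.
  rewrite -mxrank_eq0 mxrank_ker -lt0n subn_gt0.
  by rewrite mxrank_tr (leq_ltn_trans (rank_leq_row M)).
move=> /rowV0Pn [x /sub_kermxP xM x0].
have [xu xv] : dot x u = 0 /\ dot x v = 0.
  move: xM; rewrite /M tr_col_mx mul_mx_row.
  move=> /eqP; rewrite row_mx_eq0 => /andP[/eqP xu /eqP xv].
  by rewrite !dot_mulmx xu xv !mxE.
have xx : 0 < dot x x by rewrite lt_neqAle dot_ge0 eq_sym dot_eq0 x0.
exists ((Num.sqrt (dot x x))^-1 *: x); rewrite !dotZl xu xv !mulr0; split=> //.
rewrite dotZr mulrA -expr2 exprVn sqr_sqrtr ?dot_ge0 // mulVf //.
by rewrite gt_eqF.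
Qed.

Definition frame (e w k : 'rV[R]_3) : Prop :=
  [/\ dot e e = 1, dot w w = 1 & dot k k = 1] /\
  [/\ dot e w = 0, dot e k = 0 & dot w k = 0].

Definition frame_mx (e w k : 'rV[R]_3) : 'M[R]_3 :=
  \matrix_(i < 3) [:: e; w; k]`_i.

Lemma ord2P (i : 'I_2) : i = 0 \/ i = 1.
Proof. by case: i => -[|[|//]] h; [left|right]; exact/val_inj. Qed.

Lemma ord3P (i : 'I_3) : [\/ i = 0, i = 1 | i = 2].
Proof.
case: i => -[|[|[|//]]] h; [constructor 1|constructor 2|constructor 3];
  exact/val_inj.
Qed.

Lemma frame_mxK e w k : frame e w k ->
  frame_mx e w k *m (frame_mx e w k)^T = 1%:M.
Proof.
move=> [[ee ww kk] [ew ek wk]]; apply/matrixP => i j.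
have -> : (frame_mx e w k *m (frame_mx e w k)^T) i j =
    dot (row i (frame_mx e w k)) (row j (frame_mx e w k)).
  by rewrite mxE; apply: eq_bigr => l _; rewrite !mxE.
rewrite !rowK !mxE.
by have [->|->|->] := ord3P i; have [->|->|->] := ord3P j; rewrite /= // dotC.
Qed.

Lemma frame_coordinates e w k u :
  u *m (frame_mx e w k)^T = vec3 (dot u e) (dot u w) (dot u k).
Proof.
apply/rowP => i.
have -> : (u *m (frame_mx e w k)^T) 0 i = dot u (row i (frame_mx e w k)).
  by rewrite mxE; apply: eq_bigr => l _; rewrite !mxE.
by rewrite rowK mxE; have [->|->|->] := ord3P i.
Qed.

Lemma frame_expansion e w k u : frame e w k ->
  u = dot u e *: e + dot u w *: w + dot u k *: k.
Proof.
move=> /frame_mxK/mulmx1C fK.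
rewrite -[LHS]mulmx1 -fK mulmxA frame_coordinates.
by rewrite mulmx_sum_row !big_ord_recl big_ord0 !rowK !mxE /= addr0 addrA.
Qed.

Lemma vec3D (a b c a' b' c' : R) :
  vec3 a b c + vec3 a' b' c' = vec3 (a + a') (b + b') (c + c').
Proof.
by apply/rowP => i; rewrite !mxE; have [->|->|->] := ord3P i.
Qed.

Lemma vec3Z (s a b c : R) : s *: vec3 a b c = vec3 (s * a) (s * b) (s * c).
Proof.
by apply/rowP => i; rewrite !mxE; have [->|->|->] := ord3P i.
Qed.

Lemma dot_vec3 (a b c a' b' c' : R) :
  dot (vec3 a b c) (vec3 a' b' c') = a * a' + b * b' + c * c'.
Proof. by rewrite /dot !big_ord_recl big_ord0 !mxE /= addr0 addrA. Qed.

Lemma dot_mulmx_orthogonal (P : 'M[R]_3) u v :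
  P *m P^T = 1%:M -> dot (u *m P) (v *m P) = dot u v.
Proof.
by move=> PP; rewrite !dot_mulmx trmx_mul mulmxA -(mulmxA u) PP mulmx1.
Qed.

Lemma orthogonal_isometry (P : 'M[R]_3) (o : 'rV[R]_3) :
  P *m P^T = 1%:M -> Defs.isometry (fun u => (u - o) *m P).
Proof.
move=> PP u v; rewrite /Defs.edist.
have -> : (u - o) *m P - (v - o) *m P = (u - v) *m P.
  by rewrite -mulmxBl opprB addrA subrK.
by rewrite dot_mulmx_orthogonal.
Qed.

(** By polarization, S u = T u - T 0 preserves scalar products.  It sends the
standard basis to an orthonormal one, in which the coordinates of S u are those
of u. *)
Lemma isometry_affine (T : 'rV[R]_3 -> 'rV[R]_3) : Defs.isometry T ->
  exists2 P : 'M[R]_3, P *m P^T = 1%:M & forall u, T u = T 0 + u *m P.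
Proof.
move=> isoT.
have [S ST dS] : exists2 S, (forall u, S u = T u - T 0) &
    forall u v, dot (S u - S v) (S u - S v) = dot (u - v) (u - v).
  exists (fun u => T u - T 0) => // u v.
  have -> : T u - T 0 - (T v - T 0) = T u - T v by rewrite opprB addrA subrK.
  have /(congr1 (fun x => x ^+ 2)) := isoT u v.
  by rewrite !sqr_sqrtr ?dot_ge0.
have S0 : S 0 = 0 by rewrite ST subrr.
have dSS u v : dot (S u) (S v) = dot u v.
  have := dS u v; have := dS u 0; have := dS v 0.
  rewrite S0 !subr0 !dot_expand (dotC (S v)) (dotC v u); lra.
pose P : 'M[R]_3 := \matrix_i S (delta_mx 0 i).
have PP : P *m P^T = 1%:M.
  apply/matrixP => i j.
  have -> : (P *m P^T) i j = dot (row i P) (row j P).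
    by rewrite mxE; apply: eq_bigr => l _; rewrite !mxE.
  rewrite !rowK dSS /dot (bigD1 i) //= !mxE !eqxx mul1r big1 ?addr0 //.
  by move=> l li; rewrite !mxE (negbTE li) andbF mul0r.
exists P => // u.
suff -> : u *m P = S u by rewrite ST subrKC.
have uE : u = S u *m P^T.
  apply/rowP => i.
  have -> : (S u *m P^T) 0 i = dot (S u) (row i P).
    by rewrite mxE; apply: eq_bigr => l _; rewrite !mxE.
  rewrite rowK dSS /dot (bigD1 i) //= !mxE !eqxx mulr1 big1 ?addr0 //.
  by move=> l li; rewrite !mxE (negbTE li) andbF mulr0.
by rewrite [in LHS]uE -mulmxA (mulmx1C PP) mulmx1.
Qed.
End DotProduct.

(** * Flatness and principal directions in terms of the normal *)

Section ShapeOperator.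
Context {R : realType}.

(** The tangent plane, the row space of J, lies in the orthogonal of n and has
the same dimension. *)
Lemma orthogonal_tangent (J : 'M[R]_(2, 3)) (n u : 'rV[R]_3) :
  row_free J -> dot n n = 1 -> J *m n^T = 0 -> dot u n = 0 -> (u <= J)%MS.
Proof.
move=> fJ nn Jn un.
have n0 : n != 0 by rewrite -dot_eq0 nn oner_neq0.
have JK : (J <= kermx n^T)%MS by apply/sub_kermxP.
have uK : (u <= kermx n^T)%MS.
  by apply/sub_kermxP/matrixP => i j; rewrite !ord1 -dot_mulmx un mxE.
rewrite (submx_trans uK) // -(geq_leqif (mxrank_leqif_sup JK)).
by rewrite mxrank_ker mxrank_tr rank_rV n0 (eqP fJ).
Qed.

(** Here J and dN are the Jacobians of the immersion and of its normal n, and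
S is the shape operator, so that S J = - dN.  If S is singular and U is an
eigenvector for a nonzero eigenvalue, then the row space of S contains U and
has rank at most one, hence is the line of U.  Conversely, if S maps everything
into this line, it is singular, and U is an eigenvector. *)
Lemma rank_one_shape (J dN : 'M[R]_(2, 3)) (n u : 'rV[R]_3) :
  let P := pinvmx J in let U := u *m P in let S := - (dN *m P) in
  row_free J -> dot n n = 1 -> J *m n^T = 0 -> dN *m n^T = 0 ->
  dot u n = 0 -> u != 0 ->
  (\det S = 0 /\ exists2 kappa, kappa != 0 & U *m S = kappa *: U) <->
  ((forall v, exists a, v *m dN = a *: u) /\ U *m dN != 0).
Proof.
move=> P U S fJ nn Jn dNn un u0.
have UJ : U *m J = u by rewrite mulmxKpV // (orthogonal_tangent fJ nn).
have U0 : U != 0 by apply: contra_neq u0 => U0; rewrite -UJ U0 mul0mx.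
have SJ : S *m J = - dN.
  rewrite mulNmx; congr (- _); apply: mulmxKpV; apply/row_subP => i.
  apply: (orthogonal_tangent fJ nn Jn).
  by rewrite dot_mulmx -row_mul dNn row0 mxE.
split=> [[dS [kappa kappa0 US]]|[dNu UdN]].
  have US_sub : (U <= S)%MS.
    have <- : kappa^-1 *: (U *m S) = U by rewrite US scalerA mulVf // scale1r.
    exact/scalemx_sub/submxMl.
  have SU : (S <= U)%MS.
    rewrite -(geq_leqif (mxrank_leqif_sup US_sub)) rank_rV U0.
    rewrite -ltnS ltn_neqAle rank_leq_row andbT.
    apply/negP => fS; have : S \in unitmx by rewrite -row_free_unit.
    by rewrite unitmxE dS unitr0.
  split=> [v|].
    have /sub_rVP[a vS] := submx_trans (submxMl v S) SU.
    exists (- a); rewrite -[dN]opprK -SJ mulmxN mulmxA vS.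
    by rewrite -scalemxAl UJ scaleNr.
  rewrite -[dN]opprK -SJ mulmxN mulmxA US -scalemxAl UJ oppr_eq0 scaler_eq0.
  by rewrite negb_or kappa0.
have vS v : exists a, v *m S = a *: U.
  have [a vdN] := dNu v; exists (- a).
  by rewrite mulmxN mulmxA vdN -scalemxAl scaleNr.
split.
  apply/eqP; apply/negPn; rewrite -unitfE -unitmxE -row_free_unit; apply/negP.
  move=> /eqP rS.
  have : (S <= U)%MS.
    apply/row_subP => i; rewrite rowE; have [a ->] := vS (delta_mx 0 i).
    exact: scalemx_sub.
  by move=> /mxrankS; rewrite rS rank_rV U0.
have [a US] := vS U; exists a => //.
apply: contra_neq UdN => a0.
by rewrite -[dN]opprK -SJ mulmxN mulmxA US a0 scale0r mul0mx oppr0.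
Qed.
End ShapeOperator.

Section DotDerivative.
Context {R : realType} {V : normedModType R}.
Implicit Types f g : V -> 'rV[R]_3.

Lemma ndiff_dot n (D : set V) f g : open D -> ndiff n D f -> ndiff n D g ->
  ndiff n D (fun x => dot (f x) (g x)).
Proof.
move=> oD /(ndiff_mxP oD) nf /(ndiff_mxP oD) ng.
by apply: ndiff_sum => // i _; exact: ndiffM.
Qed.

Lemma differentiable_dot f g p : differentiable f p -> differentiable g p ->
  differentiable (fun x => dot (f x) (g x)) p.
Proof.
move=> /differentiable_mxP df /differentiable_mxP dg.
rewrite (_ : (fun x => _) =
  \sum_(i < 3) (fun x => f x 0 i) * (fun x => g x 0 i)); last first.
  by apply/funext => x; rewrite fct_sumE.
by apply: differentiable_sum => i; exact: differentiableM.
Qed.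

Lemma derive_dot f g p v : differentiable f p -> differentiable g p ->
  'D_v (fun x => dot (f x) (g x)) p =
    dot ('D_v f p) (g p) + dot (f p) ('D_v g p).
Proof.
move=> df dg.
have dfi i : derivable (fun x => f x 0 i : R) p v.
  by apply: diff_derivable; exact: (differentiable_mxP f p).1.
have dgi i : derivable (fun x => g x 0 i : R) p v.
  by apply: diff_derivable; exact: (differentiable_mxP g p).1.
rewrite (_ : (fun x => _) =
  \sum_(i < 3) (fun x => f x 0 i) * (fun x => g x 0 i)); last first.
  by apply/funext => x; rewrite fct_sumE.
rewrite derive_sum; last by move=> i; exact: derivableM.
rewrite -big_split /=; apply: eq_bigr => i _.
rewrite deriveM // !derive_mx_coord; [|exact: diff_derivable..].
by rewrite addrC; congr (_ + _); exact: mulrC.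
Qed.

Lemma differentiable_dot_cst f (z : 'rV[R]_3) p : differentiable f p ->
  differentiable (fun x => dot (f x) z) p.
Proof.
by move=> df; apply: differentiable_dot => //; exact: differentiable_cst.
Qed.

Lemma derive_dot_cst f (z : 'rV[R]_3) p v : differentiable f p ->
  'D_v (fun x => dot (f x) z) p = dot ('D_v f p) z.
Proof.
move=> df; have dz : differentiable (cst z : V -> _) p.
  exact: differentiable_cst.
by rewrite (derive_dot v df dz) derive_cst dot0r addr0.
Qed.
End DotDerivative.

Section Surface.
Context {R : realType} (k : 'rV[R]_3) (hk : dot k k = 1).
Context (D : set 'rV[R]_2) (oD : open D) (r N : 'rV[R]_2 -> 'rV[R]_3).
Hypotheses (hr : immersion D r) (hN : unit_normal D r N).
Hypothesis htheta : forall p, D p ->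
  0 < angle k N p < pi /\ angle k N p != pi / 2.

Lemma differentiable_immersion p : D p -> differentiable r p.
Proof. by move=> Dp; have [/(_ [::] p Dp)] := hr. Qed.

Lemma differentiable_normal p : D p -> differentiable N p.
Proof. by move=> Dp; have [/(_ [::] p Dp)] := hN. Qed.

Lemma normal_unit p : D p -> dot (N p) (N p) = 1.
Proof. by move=> Dp; have [_ /(_ p Dp)[]] := hN. Qed.

Lemma derive_normal_orthogonal p v : D p -> dot ('D_v N p) (N p) = 0.
Proof.
move=> Dp; have dN := differentiable_normal Dp.
have := derive_dot v dN dN.
rewrite (near_eq_derive (g := cst (1 : R))) ?derive_cst; last first.
  by apply: filterS (open_nbhs_nbhs (conj oD Dp)) => x; exact: normal_unit.
by rewrite dotC => /eqP; rewrite eq_sym -mulr2n mulrn_eq0 => /eqP.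
Qed.

(** Cauchy-Schwarz places <N, k> in [-1, 1], where the arc cosine is inverted
by the cosine; the excluded values 0, pi / 2 and pi of the angle exclude 1, 0
and -1. *)
Lemma cos_angle_bounds p : D p ->
  [/\ -1 < dot (N p) k, dot (N p) k < 1, dot (N p) k != 0 &
      cos (angle k N p) = dot (N p) k].
Proof.
move=> Dp; have [/andP[t0 tpi] tpi2] := htheta Dp.
have N1 := normal_unit Dp.
have := dot_ge0 (k - dot (N p) k *: N p).
move: t0 tpi tpi2; rewrite /angle !dot_expand hk N1 (dotC k).
set c := dot (N p) k => t0 tpi tpi2 c2.
have c_le : -1 <= c <= 1 by apply/andP; split; nra.
split; last by rewrite acosK // in_itv.
- rewrite lt_neqAle (andP c_le).1 andbT; apply: contraTneq tpi => <-.
  by rewrite acosN1 ltxx.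
- rewrite lt_neqAle (andP c_le).2 andbT; apply: contraTneq t0 => ->.
  by rewrite acos1 ltxx.
- by apply: contraNneq tpi2 => ->; rewrite acos0.
Qed.

Lemma jacobian_normal p : D p -> 'J r p *m (N p)^T = 0.
Proof.
move=> Dp; have dr := differentiable_immersion Dp.
apply/row_matrixP => i; rewrite row_mul rowE row0 -deriveEjacobian //.
have [_ /(_ p Dp)[_ /(_ (delta_mx 0 i)) rN]] := hN.
by apply/matrixP => a b; rewrite !ord1 -dot_mulmx rN mxE.
Qed.

Lemma derive_tangent_lift p u : D p -> dot u (N p) = 0 ->
  'D_(u *m pinvmx ('J r p)) r p = u.
Proof.
move=> Dp uN; have dr := differentiable_immersion Dp.
have [_ /(_ p Dp) fJ] := hr.
rewrite deriveEjacobian //; apply: mulmxKpV.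
exact: orthogonal_tangent fJ (normal_unit Dp) (jacobian_normal Dp) uN.
Qed.

(** The pointwise form of the curvature hypothesis used in both directions.
With u the vector U of E^3, the two clauses say that the range of the shape
operator lies in the line of U, and that U is not in its kernel. *)
Lemma flat_canonical_iff :
  (flat D r N /\ canonical_principal_direction k D r N) <->
  forall p, D p -> let u := k - dot (N p) k *: N p in
    (forall v, exists a, 'D_v N p = a *: u) /\
    (forall t, 'D_t r p = u -> 'D_t N p != 0).
Proof.
have key p : D p -> let u := k - dot (N p) k *: N p in
   (gauss_curvature r N p = 0 /\ exists2 kappa, kappa != 0 &
      tangent_part k r N p *m shape_operator r N p
        = kappa *: tangent_part k r N p) <->
   ((forall v, exists a, 'D_v N p = a *: u) /\
    (forall t, 'D_t r p = u -> 'D_t N p != 0)).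
  move=> Dp u.
  have [c_gt c_lt c0 cosE] := cos_angle_bounds Dp.
  have N1 := normal_unit Dp.
  have dr := differentiable_immersion Dp; have dN := differentiable_normal Dp.
  have fJ : row_free ('J r p) by have [_ /(_ p Dp)] := hr.
  have JN := jacobian_normal Dp.
  have dNN : 'J N p *m (N p)^T = 0.
    apply/row_matrixP => i; rewrite row_mul rowE row0 -deriveEjacobian //.
    apply/matrixP => a b; rewrite !ord1 -dot_mulmx mxE.
    exact: derive_normal_orthogonal.
  have uN : dot u (N p) = 0 by rewrite /u !dot_expand N1 mulr1 dotC subrr.
  have u0 : u != 0.
    have uu : dot u u = 1 - dot (N p) k ^+ 2.
      by rewrite /u !dot_expand hk N1 (dotC k); ring.
    by rewrite -dot_eq0 uu gt_eqF //; nra.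
  have uJ : u *m pinvmx ('J r p) *m 'J r p = u.
    by rewrite -deriveEjacobian // derive_tangent_lift.
  have UE : tangent_part k r N p = u *m pinvmx ('J r p).
    by rewrite /tangent_part cosE.
  rewrite UE /gauss_curvature /shape_operator.
  apply: (iff_trans (rank_one_shape fJ N1 JN dNN uN u0)).
  split=> -[dNu UN]; split.
  - by move=> v; have [a E] := dNu v; exists a; rewrite deriveEjacobian.
  - move=> t; rewrite !deriveEjacobian // -[in RHS]uJ => /(row_free_inj fJ) ->.
    exact: UN.
  - by move=> v; have [a E] := dNu v; exists a; rewrite -deriveEjacobian.
  - by rewrite -deriveEjacobian //; apply: UN; rewrite deriveEjacobian.
split=> [[fl [kappa hkappa]] p Dp|H].
  apply/key => //; split; first exact: fl.
  by have [E kp0] := hkappa p Dp; exists (kappa p).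
have H' p : exists kappa, D p -> gauss_curvature r N p = 0 /\
    (tangent_part k r N p *m shape_operator r N p
        = kappa *: tangent_part k r N p /\ kappa != 0).
  have [Dp|nDp] := pselect (D p); last by exists 0.
  by have /key [//|g0 [kappa kp0 E]] := H p Dp; exists kappa.
have [kappa hkappa] := choice H'.
split=> [p /hkappa[]//|]; exists kappa => p /hkappa[_]; exact.
Qed.
End Surface.

(** * Cylinders in an orthonormal frame *)

Section FramedCylinder.
Context {R : realType}.

Lemma is_derive0_interval_cst (I : set R) (h : R -> R) : is_interval I ->
  (forall x, I x -> is_derive x 1 h 0) -> forall x y, I x -> I y -> h x = h y.
Proof.
move=> itvI dh x y; wlog xy : x y / x <= y => [H Ix Iy|Ix Iy].
  by have /orP[xy|yx] := le_total x y; [exact: H|exact/esym/H].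
have Ixy z : z \in `[x, y] -> I z by rewrite in_itv /= => zxy; exact: itvI zxy.
have dh' z : z \in `]x, y[ -> is_derive z 1 h (cst (0 : R) z).
  by move=> /subset_itv_oo_cc/Ixy; exact: dh.
have ch : {within `[x, y], continuous h}.
  by apply: derivable_within_continuous => z /Ixy/dh[].
have [c _ ] := MVT_segment xy dh' ch.
by rewrite mul0r => /eqP; rewrite subr_eq0 => /eqP.
Qed.

(** The local parametrization written with coordinates phi, y, psi in an
orthonormal frame (e, w, k), in place of an isometry applied to the standard
form.  Here psi is any primitive of sin theta; the origin o absorbs the
constant of integration. *)
Definition framed_cylinder (k : 'rV[R]_3) (D : set 'rV[R]_2)
    (r : 'rV[R]_2 -> 'rV[R]_3) (p : 'rV[R]_2) : Prop :=
  exists (V W : set 'rV[R]_2) (F : 'rV[R]_2 -> 'rV[R]_2)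
         (I : set R) (theta phi psi : R -> R) (e w o : 'rV[R]_3),
    [/\ [/\ open V, V p & V `<=` D],
        open W /\ diffeomorphism W V F,
        frame e w k,
        [/\ open I, is_interval I, I 0,
            smooth_on I theta
          & forall x, I x ->
              [/\ 0 < theta x < pi, theta x != pi / 2,
                  derive1 theta x != 0,
                  is_derive x 1 phi (cos (theta x))
                & is_derive x 1 psi (sin (theta x))]]
      & forall q, W q ->
          I (q 0 0) /\
          r (F q) = o + phi (q 0 0) *: e + q 0 1 *: w + psi (q 0 0) *: k].

Lemma sin_profile_continuous (I : set R) (theta : R -> R) :
  smooth_on I theta ->
  forall x, I x -> {for x, continuous (fun t => sin (theta t))}.
Proof.
move=> sth x Ix; apply: continuous_comp; last exact: continuous_sin.
by apply: differentiable_continuous; exact: (sth [::]).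
Qed.

Lemma oriented_integralxx (c : R) (f : R -> R) : oriented_integral c c f = 0.
Proof. by rewrite /oriented_integral lexx set_itv1 Rintegral_set1. Qed.

Lemma frame_expand_coordinates e w k (a b c : R) : frame e w k ->
  (a *: e + b *: w + c *: k) *m (frame_mx e w k)^T = vec3 a b c.
Proof.
move=> [[ee ww kk] [ew ek wk]].
rewrite frame_coordinates !dot_expand ee ww kk ew ek wk.
rewrite (dotC w e) (dotC k e) (dotC k w) ew ek wk.
by congr (vec3 _ _ _); ring.
Qed.

(** Taking frame coordinates is an isometry carrying k to the third axis; it
puts the surface in standard form with y0 = 0. *)
Lemma framed_locally_cylinder k D r :
  (forall p, D p -> framed_cylinder k D r p) -> locally_cylinder k D r.
Proof.
move=> H p /H.
move=> [V [W [F [I [theta [phi [psi [e [w [p0 [hV hW fr hI hq]]]]]]]]]]].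
have [oI itvI I0 sth hth] := hI.
pose Q := frame_mx e w k.
have QQ : Q^T *m Q^T^T = 1%:M by rewrite trmxK; exact/mulmx1C/frame_mxK.
have kQ : k *m Q^T = vec3 0 0 1.
  by rewrite -(frame_expand_coordinates 0 0 1 fr) !scale0r !add0r scale1r.
have psiE x : I x ->
    psi x - psi 0 = oriented_integral 0 x (fun t => sin (theta t)).
  move=> Ix.
  have dh y : I y -> is_derive y 1
      (fun y => psi y - oriented_integral 0 y (fun t => sin (theta t))) 0.
    move=> Iy; have [_ _ _ _ dpsi] := hth y Iy.
    have dO := is_derive_oriented_integral oI itvI I0 Iy
      (sin_profile_continuous sth).
    by have := is_deriveB dpsi dO; rewrite subrr.
  have := is_derive0_interval_cst itvI dh Ix I0.
  by rewrite oriented_integralxx; lra.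
exists V, W, F, (fun u => (u - (p0 + psi 0 *: k)) *m Q^T), I, theta, phi, 0.
split=> //.
- split; first exact: orthogonal_isometry.
  by move=> u; rewrite -kQ -mulmxDl; congr (_ *m _); rewrite addrAC.
- by split=> // x /hth[].
move=> q /hq [Iq ->]; split=> //.
have -> : p0 + phi (q 0 0) *: e + q 0 1 *: w + psi (q 0 0) *: k
    - (p0 + psi 0 *: k) =
    phi (q 0 0) *: e + q 0 1 *: w + (psi (q 0 0) - psi 0) *: k.
  by apply/rowP => i; rewrite !mxE; ring.
rewrite frame_expand_coordinates // psiE // /cylinder_param vec3Z vec3D.
by rewrite cos0 sin0; congr (vec3 _ _ _); ring.
Qed.

(** The rotation by y0 and the orthogonal part P of T are absorbed in the
frame: e and w are the preimages under P of the profile direction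
(cos y0, sin y0, 0) and of v0. *)
Lemma locally_framed_cylinder k D r : dot k k = 1 ->
  locally_cylinder k D r -> forall p, D p -> framed_cylinder k D r p.
Proof.
move=> hk H p /H.
move=> [V [W [F [T [I [theta [phi [y0 [hV hW [isoT carT] hI hq]]]]]]]]].
have [oI itvI I0 sth hth] := hI.
have [P PP TE] := isometry_affine isoT.
have kP : k *m P = vec3 0 0 1.
  have := carT 0; rewrite add0r TE [X in _ = X + _]TE mul0mx addr0.
  exact: addrI.
have kE : k = vec3 0 0 1 *m P^T by rewrite -kP -mulmxA PP mulmx1.
have PTP : P^T *m P^T^T = 1%:M by rewrite trmxK; exact: mulmx1C.
pose a := vec3 (cos y0) (sin y0) 0; pose b := vec3 (- sin y0) (cos y0) 0.
have c2s2 := cos2Dsin2 y0.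
exists V, W, F, I, theta, phi,
  (fun x => oriented_integral 0 x (fun t => sin (theta t))),
  (a *m P^T), (b *m P^T), (- T 0 *m P^T).
split=> //.
- have dP u v := dot_mulmx_orthogonal u v PTP.
  rewrite kE; split; split; rewrite dP dot_vec3 //; try ring.
  + by rewrite -c2s2; ring.
  + by rewrite -c2s2; ring.
- split=> // x Ix; have [? ? ? ?] := hth x Ix; split=> //.
  exact: is_derive_oriented_integral oI itvI I0 Ix (sin_profile_continuous sth).
move=> q /hq [Iq rE]; split=> //.
have -> : r (F q) = (T (r (F q)) - T 0) *m P^T.
  by rewrite TE addrC addKr -mulmxA PP mulmx1.
rewrite rE /cylinder_param kE !scalemxAl -!mulmxDl; congr (_ *m _).
rewrite /a /b !vec3Z; apply/rowP => i; rewrite !mxE.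
by have [->|->|->] := ord3P i; rewrite /=; ring.
Qed.
End FramedCylinder.

(** * Framed cylinders are flat with canonical principal direction *)

Section ChainRules.
Context {R : realType}.

Lemma derive_chain (U V W : normedModType R) (f : U -> V) (g : V -> W) p v :
  differentiable f p -> differentiable g (f p) ->
  'D_v (g \o f) p = 'D_('D_v f p) g (f p).
Proof.
move=> df dg; rewrite deriveE; last exact: differentiable_comp.
by rewrite diff_comp //= -(deriveE v df) (deriveE _ dg).
Qed.

Lemma is_derive_chain_real (V : normedModType R) (c : V -> R) (h : R -> R)
    (dh : R) p v :
  differentiable c p -> is_derive (c p) 1 h dh ->
  differentiable (h \o c) p /\ 'D_v (h \o c) p = 'D_v c p * dh.
Proof.
move=> dc [/derivable1_diffP dh_p <-].
split; first exact: differentiable_comp.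
rewrite derive_chain // !(deriveE _ dh_p).
by rewrite -[X in 'd h (c p) X = _]mulr1 -[_ * 1]/(_ *: (1 : R)) linearZ.
Qed.

Lemma derive_coord n (p v : 'rV[R]_n) i :
  'D_v (fun q : 'rV[R]_n => q 0 i : R) p = v 0 i.
Proof.
by rewrite -(derive_mx_coord (f := id)) ?derive_id //; exact: derivable_id.
Qed.

Lemma derive_inverse n (V : set 'rV[R]_n) (F G : 'rV[R]_n -> 'rV[R]_n) p v :
  open V -> V p -> (forall x, V x -> F (G x) = x) ->
  differentiable G p -> differentiable F (G p) ->
  'D_('D_v G p) F (G p) = v.
Proof.
move=> oV Vp FG dG dF; rewrite -derive_chain //.
rewrite (near_eq_derive (g := id)) ?derive_id //.
by apply: filterS (open_nbhs_nbhs (conj oV Vp)) => x /FG.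
Qed.
End ChainRules.

(** Here (a, g) are the components of the normal along e and k, (c, s) =
(cos theta, sin theta), primes denote a derivative, and tau is that of theta.
The hypotheses are the orthogonality of the normal to the profile tangent
(c, s), the normalization of (a, g), and the derivatives of both; in the
rotated frame (c, s), (-s, c) they determine (a, g) up to the sign sigma, and
its derivative completely. *)
Lemma rotated_normal_algebra (R : realType) (a g a' g' c s tau : R) :
  c ^+ 2 + s ^+ 2 = 1 -> a ^+ 2 + g ^+ 2 = 1 -> a * c + g * s = 0 ->
  a * a' + g * g' = 0 ->
  a' * c - a * s * tau + g' * s + g * c * tau = 0 ->
  let sigma := g * c - a * s in
  [/\ sigma ^+ 2 = 1, a = - (sigma * s), g = sigma * c,
      a' = - (tau * sigma) * c & g' = - (tau * sigma) * s].
Proof.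
move=> cs ag h1 h2 h3 sigma.
have sig2 : sigma ^+ 2 = 1.
  have -> : sigma ^+ 2 =
    (a ^+ 2 + g ^+ 2) * (c ^+ 2 + s ^+ 2) - (a * c + g * s) ^+ 2.
    by rewrite /sigma; ring.
  by rewrite ag cs h1; ring.
have aE : a = - (sigma * s).
  have -> : a = a * (c ^+ 2 + s ^+ 2) by rewrite cs mulr1.
  have -> : a * (c ^+ 2 + s ^+ 2) = c * (a * c + g * s) - sigma * s.
    by rewrite /sigma; ring.
  by rewrite h1; ring.
have gE : g = sigma * c.
  have -> : g = g * (c ^+ 2 + s ^+ 2) by rewrite cs mulr1.
  have -> : g * (c ^+ 2 + s ^+ 2) = s * (a * c + g * s) + sigma * c.
    by rewrite /sigma; ring.
  by rewrite h1; ring.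
have tangential : a' * c + g' * s = - (tau * sigma).
  have -> : a' * c + g' * s =
    (a' * c - a * s * tau + g' * s + g * c * tau) - tau * sigma.
    by rewrite /sigma; ring.
  by rewrite h3; ring.
have normal : g' * c - a' * s = 0.
  have -> : g' * c - a' * s = sigma ^+ 2 * (g' * c - a' * s).
    by rewrite sig2 mul1r.
  have -> : sigma ^+ 2 * (g' * c - a' * s) =
    sigma * (- (sigma * s) * a' + sigma * c * g') by ring.
  by rewrite -aE -gE h2 mulr0.
split=> //.
  have -> : a' = a' * (c ^+ 2 + s ^+ 2) by rewrite cs mulr1.
  have -> : a' * (c ^+ 2 + s ^+ 2) =
    c * (a' * c + g' * s) - s * (g' * c - a' * s) by ring.
  by rewrite tangential normal; ring.
have -> : g' = g' * (c ^+ 2 + s ^+ 2) by rewrite cs mulr1.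
have -> : g' * (c ^+ 2 + s ^+ 2) =
  s * (a' * c + g' * s) + c * (g' * c - a' * s) by ring.
by rewrite tangential normal; ring.
Qed.

Section FromFramedCylinder.
Context {R : realType} (k : 'rV[R]_3) (hk : dot k k = 1).
Context (D : set 'rV[R]_2) (oD : open D) (r N : 'rV[R]_2 -> 'rV[R]_3).
Hypotheses (hr : immersion D r) (hN : unit_normal D r N).

(** In the coordinates of the cylinder, with E = cos theta e + sin theta k the
profile tangent, D_X N = - X_0 theta' sigma E and u = sin theta E.  A vector t
with D_t r = u has first coordinate sin theta, so D_t N does not vanish. *)
Lemma framed_cylinder_normal_derivative p : D p -> framed_cylinder k D r p ->
  let u := k - dot (N p) k *: N p in
  (forall v, exists a, 'D_v N p = a *: u) /\
  (forall t, 'D_t r p = u -> 'D_t N p != 0).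
Proof.
move=> Dp [V [W [F [I [theta [phi [psi [e [w [p0 [hV hW fr hI hq]]]]]]]]]]] u.
have [oV Vp VD] := hV; have [oW [sF [G [sG FW GV]]]] := hW.
have [oI itvI I0 sth hth] := hI.
have [[ee ww _] [ew ek wk]] := fr.
have [we ke kw] : [/\ dot w e = 0, dot k e = 0 & dot k w = 0].
  by rewrite (dotC w) (dotC k e) (dotC k w).
have dF q : W q -> differentiable F q by move=> Wq; exact: (sF [::]).
have drF q : W q -> differentiable (r \o F) q.
  move=> Wq; apply: differentiable_comp; first exact: dF.
  by apply: (differentiable_immersion hr); apply: VD; have [] := FW q Wq.
have dNF q : W q -> differentiable (N \o F) q.
  move=> Wq; apply: differentiable_comp; first exact: dF.
  by apply: (differentiable_normal hN); apply: VD; have [] := FW q Wq.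
have near_W q : W q -> \forall z \near q, W z.
  by move=> Wq; exact: open_nbhs_nbhs (conj oW Wq).
have dx q : differentiable (fun z : 'rV[R]_2 => z 0 0 : R) q.
  exact: differentiable_coord.
have derivative_rF q X : W q -> let th := theta (q 0 0) in
    'D_X (r \o F) q =
      (X 0 0 * cos th) *: e + X 0 1 *: w + (X 0 0 * sin th) *: k.
  move=> Wq th; have [Iq rFE] := hq q Wq.
  have [_ _ _ dphi dpsi] := hth _ Iq.
  have dot_const z := derive_dot_cst z X (drF q Wq).
  rewrite [LHS](frame_expansion _ fr); congr (_ *: _ + _ *: _ + _ *: _).
  - rewrite -dot_const.
    rewrite (near_eq_derive
      (g := fun y : 'rV[R]_2 => dot p0 e + phi (y 0 0))); last first.
      apply: filterS (near_W q Wq) => y Wy /=; have [_ ->] := hq y Wy.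
      by rewrite !dot_expand ee we ke; ring.
    have [dpx DE] := is_derive_chain_real X (dx q) dphi.
    rewrite deriveD; [|exact: derivable_cst|exact: diff_derivable].
    by rewrite derive_cst add0r [LHS]DE derive_coord.
  - rewrite -dot_const.
    rewrite (near_eq_derive
      (g := fun y : 'rV[R]_2 => dot p0 w + y 0 1)); last first.
      apply: filterS (near_W q Wq) => y Wy /=; have [_ ->] := hq y Wy.
      by rewrite !dot_expand ww ew kw; ring.
    rewrite deriveD; [|exact: derivable_cst|].
      by rewrite derive_cst add0r derive_coord.
    by apply: diff_derivable; exact: differentiable_coord.
  - rewrite -dot_const.
    rewrite (near_eq_derive
      (g := fun y : 'rV[R]_2 => dot p0 k + psi (y 0 0))); last first.
      apply: filterS (near_W q Wq) => y Wy /=; have [_ ->] := hq y Wy.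
      by rewrite !dot_expand hk ek wk; ring.
    have [dpx DE] := is_derive_chain_real X (dx q) dpsi.
    rewrite deriveD; [|exact: derivable_cst|exact: diff_derivable].
    by rewrite derive_cst add0r [LHS]DE derive_coord.
have normal_rF q X : W q -> dot ('D_X (r \o F) q) (N (F q)) = 0.
  move=> Wq; have [VFq _] := FW q Wq; have DFq := VD _ VFq.
  rewrite derive_chain; [|exact: dF|exact: (differentiable_immersion hr DFq)].
  by have [_ /(_ _ DFq)[_]] := hN; apply.
pose al q := dot ((N \o F) q) e; pose ga q := dot ((N \o F) q) k.
(* the derivative of r o F along the second axis is the ruling w, the one
   along the first axis is the profile tangent *)
have bet0 q : W q -> dot ((N \o F) q) w = 0.
  move=> Wq; have := normal_rF q (delta_mx 0 1) Wq.
  rewrite derivative_rF // !mxE /= !mul0r !scale0r add0r addr0 scale1r.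
  by rewrite dotC.
have alga q : W q ->
    al q * cos (theta (q 0 0)) + ga q * sin (theta (q 0 0)) = 0.
  move=> Wq; have := normal_rF q (delta_mx 0 0) Wq.
  rewrite derivative_rF // !mxE /= !mul1r scale0r addr0 !dot_expand.
  by rewrite (dotC e) (dotC k); rewrite mulrC [X in _ + X]mulrC.
have [WGp FGp] := GV p Vp; set q0 := G p in WGp FGp.
have [Iq0 _] := hq q0 WGp; set th := theta (q0 0 0).
have [th0 _ th' _ _] := hth _ Iq0.
set tau := derive1 theta (q0 0 0) in th'.
have nE q : W q -> (N \o F) q = al q *: e + ga q *: k.
  move=> Wq; rewrite {1}(frame_expansion ((N \o F) q) fr).
  by rewrite bet0 // scale0r addr0.
have al2ga2 q : W q -> al q ^+ 2 + ga q ^+ 2 = 1.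
  move=> Wq; have [VFq _] := FW q Wq.
  have := normal_unit hN (VD _ VFq); rewrite -[N (F q)]/((N \o F) q) nE //.
  by rewrite !dot_expand ee hk ek ke => <-; ring.
have dal : differentiable al q0.
  by apply: differentiable_dot; [exact: dNF|exact: differentiable_cst].
have dga : differentiable ga q0.
  by apply: differentiable_dot; [exact: dNF|exact: differentiable_cst].
have dth : is_derive (q0 0 0) 1 theta tau.
  split; last by rewrite -derive1E.
  by apply/derivable1_diffP; exact: (sth [::]).
have algebra X : let sigma := ga q0 * cos th - al q0 * sin th in
  [/\ sigma ^+ 2 = 1, al q0 = - (sigma * sin th), ga q0 = sigma * cos th,
      'D_X al q0 = - (X 0 0 * tau * sigma) * cos th &
      'D_X ga q0 = - (X 0 0 * tau * sigma) * sin th].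
  have [dthx DthE] := is_derive_chain_real X (dx q0) dth.
  have [dcos DcosE] := is_derive_chain_real X dthx (is_derive_cos _).
  have [dsin DsinE] := is_derive_chain_real X dthx (is_derive_sin _).
  rewrite DthE derive_coord in DcosE DsinE.
  apply: rotated_normal_algebra.
  - exact: cos2Dsin2.
  - exact: al2ga2.
  - exact: alga.
  - have : 'D_X (fun y => al y * al y + ga y * ga y) q0 = 0.
      rewrite (near_eq_derive (g := cst (1 : R))) ?derive_cst //.
      by apply: filterS (near_W _ WGp) => y /al2ga2; rewrite !expr2.
    rewrite deriveD; [|apply: derivableM; exact: diff_derivable..].
    rewrite !deriveM; [|exact: diff_derivable..].
    rewrite /GRing.scale /= => H; lra.
  - have : 'D_X (fun y : 'rV[R]_2 => al y * cos (theta (y 0 0)) +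
                                    ga y * sin (theta (y 0 0))) q0 = 0.
      rewrite (near_eq_derive (g := cst (0 : R))) ?derive_cst //.
      by apply: filterS (near_W _ WGp) => y /alga.
    rewrite deriveD; [|apply: derivableM; exact: diff_derivable..].
    rewrite !deriveM; [|exact: diff_derivable..].
    rewrite [X in _ *: X + _ + _ = 0 -> _]DcosE.
    rewrite [X in _ + (_ *: X + _) = 0 -> _]DsinE.
    by rewrite /GRing.scale /= -/th => <-; ring.
pose sigma := ga q0 * cos th - al q0 * sin th.
have [sig2 alE gaE _ _] := algebra 0; rewrite -/sigma in sig2 alE gaE.
have s0 : 0 < sin th by exact: sin_gt0_pi.
have NpE : N p = al q0 *: e + ga q0 *: k by rewrite -nE //= FGp.
have uE : u = sin th *: (cos th *: e + sin th *: k).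
  have c2s2 := cos2Dsin2 th.
  rewrite /u NpE !dot_expand ek hk alE gaE.
  have E1 : sin th * sin th = 1 - sigma * cos th * (sigma * cos th).
    have -> : sigma * cos th * (sigma * cos th) = sigma ^+ 2 * cos th ^+ 2.
      by ring.
    by rewrite sig2 mul1r -c2s2; ring.
  have E2 : sin th * cos th = sigma * cos th * (sigma * sin th).
    have -> : sigma * cos th * (sigma * sin th) =
      sigma ^+ 2 * (sin th * cos th) by ring.
    by rewrite sig2 mul1r.
  rewrite [RHS]scalerDr [in RHS]scalerA [in RHS]scalerA E1 E2.
  by apply/rowP => i; rewrite !mxE; ring.
have DNE X : 'D_X (N \o F) q0 =
    - (X 0 0 * tau * sigma) *: (cos th *: e + sin th *: k).
  have [_ _ _ Dal Dga] := algebra X; rewrite -/sigma in Dal Dga.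
  have dot_const z := derive_dot_cst z X (dNF q0 WGp).
  rewrite [LHS](frame_expansion _ fr) -!dot_const.
  rewrite [X in X *: e]Dal [X in X *: k]Dga.
  rewrite (near_eq_derive (g := cst (0 : R))) ?derive_cst ?scale0r ?addr0.
    by rewrite scalerDr !scalerA.
  by apply: filterS (near_W _ WGp) => y /bet0.
have dG : differentiable G p by exact: (sG [::]).
(* every tangent vector v at p is the image under DF of the derivative of the
   coordinate map G along v *)
have pull v : 'D_('D_v G p) F q0 = v.
  by apply: derive_inverse oV Vp _ dG (dF _ WGp) => // x /GV[].
have DN v : 'D_v N p = 'D_('D_v G p) (N \o F) q0.
  rewrite [RHS]derive_chain; [|exact: dF|]; rewrite ?pull ?FGp //.
  exact: (differentiable_normal hN Dp).
have Dr v : 'D_v r p = 'D_('D_v G p) (r \o F) q0.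
  rewrite [RHS]derive_chain; [|exact: dF|]; rewrite ?pull ?FGp //.
  exact: (differentiable_immersion hr Dp).
split=> [v|t].
  exists (- (('D_v G p) 0 0 * tau * sigma) / sin th).
  by rewrite DN DNE uE scalerA divfK // gt_eqF.
rewrite Dr derivative_rF // DN DNE uE => /(congr1 (fun z => dot z k)).
rewrite !dot_expand ek wk hk !mulr0 !mulr1 !add0r.
move=> /(mulIf (negbT (gt_eqF s0))) X0.
apply/eqP => /(congr1 (fun z => dot z k)); rewrite !dot_expand ek hk X0 => /eqP.
rewrite mulr0 add0r mulr1 mulf_eq0 oppr_eq0 !mulf_eq0 (gt_eqF s0).
rewrite (negbTE th') /= orbF => /eqP sig0; move: sig2.
by rewrite sig0 expr0n /= => /eqP; rewrite eq_sym oner_eq0.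
Qed.
End FromFramedCylinder.

(** * Functions depending on the first coordinate only *)

Section FibreConstant.
Context {R : realType}.
Implicit Types (f : 'rV[R]_2 -> R) (q v : 'rV[R]_2).

Definition axis (x : R) : 'rV[R]_2 := x *: delta_mx 0 0.

Lemma axis_coord x : axis x 0 0 = x.
Proof. by rewrite !mxE /= mulr1. Qed.

Lemma ball_axis (e : R) x : ball (0 : R) e x -> ball (0 : 'rV[R]_2) e (axis x).
Proof.
rewrite -!ball_normE /= !sub0r !normrN => xe.
rewrite (le_lt_trans _ xe) //; apply: ler_mx_norm => // i j.
rewrite !mxE normrM ler_piMr //.
by case: (_ && _); rewrite ?normr1 ?normr0.
Qed.

Lemma ball_coord (e : R) q i :
  ball (0 : 'rV[R]_2) e q -> ball (0 : R) e (q 0 i).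
Proof.
rewrite -!ball_normE /= !sub0r !normrN; apply: le_lt_trans.
exact: ler_coord_norm.
Qed.

Lemma fibre_constant f (e : R) :
  (forall q, ball 0 e q -> differentiable f q /\ 'D_(delta_mx 0 1) f q = 0) ->
  forall q, ball 0 e q -> f q = f (axis (q 0 0)).
Proof.
move=> df q Bq; have Ba := ball_axis (ball_coord 0 Bq).
have dfB x : ball 0 e x -> differentiable f x by move=> /df[].
have [c /df[dfc f1]] := mean_value_ball dfB Ba Bq.
have -> : q - axis (q 0 0) = q 0 1 *: delta_mx 0 1.
  apply/rowP => i; rewrite !mxE /=.
  by have [->|->] := ord2P i; rewrite ?mulr1 ?mulr0 ?subrr ?subr0.
rewrite (deriveE _ dfc) linearZZ -(deriveE _ dfc) f1 scaler0.
by move=> /eqP; rewrite subr_eq0 => /eqP.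
Qed.

(** f = f o L for the projection L of the plane onto the first axis, and D_v f
is computed by the chain rule.  In particular the derivative of f along the
first axis is again a function of the first coordinate only. *)
Lemma derive_fibre_constant f (e : R) q v :
  (forall x, ball 0 e x -> differentiable f x) ->
  (forall x, ball 0 e x -> f x = f (axis (x 0 0))) -> ball 0 e q ->
  'D_v f q = v 0 0 * 'D_(delta_mx 0 0) f (axis (q 0 0)).
Proof.
move=> df fE Bq.
pose L : {linear 'rV[R]_2 -> 'rV[R]_2} := mulmxr (delta_mx 0 0).
have LE x : L x = axis (x 0 0).
  rewrite /L /= /axis; apply/rowP => i.
  by rewrite !mxE big_ord_recl big_ord1 !mxE /= mulr0 addr0.
have cL : continuous L by exact: mulmxr_continuous.
have dL : differentiable L q by exact: linear_differentiable.
rewrite (near_eq_derive (g := f \o L)); last first.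
  have : \forall x \near q, ball 0 e x.
    by apply: open_nbhs_nbhs; split=> //; exact: ball_open.
  by apply: filterS => x /fE ->; rewrite -[RHS]/(f (L x)) LE.
have dfL : differentiable f (L q).
  by rewrite LE; apply/df/ball_axis/ball_coord.
have DL : 'D_v L q = axis (v 0 0).
  have dI : differentiable (id : 'rV[R]_2 -> 'rV[R]_2) q by [].
  by have := derive_linear v cL dI; rewrite derive_id LE.
rewrite derive_chain // DL; rewrite LE in dfL *.
by rewrite (deriveE _ dfL) linearZZ -(deriveE _ dfL).
Qed.

Lemma is_derive_axis f (x : R) : differentiable f (axis x) ->
  is_derive x 1 (f \o axis) ('D_(delta_mx 0 0) f (axis x)).
Proof.
move=> df; have := @is_derive_line _ _ _ f 0 (delta_mx 0 0) x.
have df' : derivable f (axis x) (delta_mx 0 0) by exact: diff_derivable.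
rewrite add0r => /(_ df').
by congr is_derive; apply/funext => t; rewrite add0r.
Qed.

Lemma ndiff_axis n (I : set R) : open I -> ndiff n I axis.
Proof.
move=> oI; apply/(ndiff_mxP oI) => i j.
apply: (eq_ndiff oI
  (f := fun x => x * (delta_mx 0 0 : 'rV[R]_2) i j)) => [x _|].
  by rewrite [RHS]mxE.
by apply: ndiffM => //; [exact: ndiff_id|exact: ndiff_cst].
Qed.

End FibreConstant.

(** * Construction of the cylindrical chart *)

Section VerticalPlane.
Context {R : realType} (k : 'rV[R]_3) (hk : dot k k = 1).
Context (D : set 'rV[R]_2) (r N : 'rV[R]_2 -> 'rV[R]_3).
Hypothesis hN : unit_normal D r N.
Hypothesis htheta : forall p, D p ->
  0 < angle k N p < pi /\ angle k N p != pi / 2.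
Hypothesis dNu : forall p, D p -> forall v, exists a,
  'D_v N p = a *: (k - dot (N p) k *: N p).

(** With c = <N, k> and h = <N, w>, the hypothesis D_v N = a (k - c N) gives
D_v h = - a c h and D_v (1 - c^2) = - 2 a c (1 - c^2): the functions h^2 and
1 - c^2 have the same logarithmic derivative, so their quotient f is constant
on the ball, and it vanishes at the center. *)
Lemma normal_in_vertical_plane (p : 'rV[R]_2) (d : R) (w : 'rV[R]_3) :
  ball p d `<=` D -> dot k w = 0 -> dot (N p) w = 0 ->
  forall q, ball p d q -> dot (N q) w = 0.
Proof.
move=> BD kw Npw q Bq.
pose c x := dot (N x) k; pose h x := dot (N x) w.
pose g : 'rV[R]_2 -> R := cst 1 - c * c.
have gE x : g x = 1 - c x * c x by [].
have g0 x : ball p d x -> g x != 0.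
  move=> /BD Dx; have [c_gt c_lt _ _] := cos_angle_bounds hk hN htheta Dx.
  by rewrite gE gt_eqF //; rewrite -/(c x) in c_gt c_lt; nra.
pose f : 'rV[R]_2 -> R := (h * h) * (fun x => (g x)^-1).
have df x : ball p d x -> differentiable f x /\ forall v, 'D_v f x = 0.
  move=> Bx; have Dx := BD x Bx; have dN := differentiable_normal hN Dx.
  have dh : differentiable h x by exact: differentiable_dot_cst.
  have dc : differentiable c x by exact: differentiable_dot_cst.
  have dhh : differentiable (h * h) x by exact: differentiableM.
  have dcc : differentiable (c * c) x by exact: differentiableM.
  have dg : differentiable g x.
    by apply: differentiableB => //; exact: differentiable_cst.
  have dV : differentiable (fun y => (g y)^-1) x.
    by apply: differentiableV => //; exact: g0.
  split; first exact: differentiableM.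
  move=> v; have [a DN] := dNu Dx v.
  have Dh : 'D_v h x = - (a * c x * h x).
    by rewrite derive_dot_cst // DN !dot_expand kw -/(c x) -/(h x); ring.
  have Dc : 'D_v c x = a * g x.
    by rewrite gE derive_dot_cst // DN !dot_expand hk -/(c x); ring.
  have Dg : 'D_v g x = - (2 * a * c x * g x).
    rewrite deriveB; [|exact: derivable_cst|exact: diff_derivable].
    rewrite deriveM; [|exact: diff_derivable..].
    by rewrite derive_cst Dc /GRing.scale /=; ring.
  have Dhh : 'D_v (h * h) x = - (2 * a * c x * (h x * h x)).
    rewrite deriveM; [|exact: diff_derivable..].
    by rewrite Dh /GRing.scale /=; ring.
  rewrite /f deriveM; [|exact: diff_derivable..].
  rewrite deriveV; [|exact: g0|exact: diff_derivable].
  rewrite Dg Dhh -[(h * h) x]/(h x * h x) /GRing.scale /=.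
  by field; exact: g0.
have fq : f q = 0.
  rewrite (derive0_ball_cst df Bq).
  by rewrite -[f p]/(h p * h p * _) /h Npw !mul0r.
have : h q * h q * (g q)^-1 = 0 by exact: fq.
move=> /eqP; rewrite mulf_eq0 invr_eq0 (negbTE (g0 q Bq)) orbF mulf_eq0 orbb.
by move=> /eqP.
Qed.
End VerticalPlane.

Lemma unit_circle_cot (R : realType) (c s c' s' : R) : c ^+ 2 + s ^+ 2 = 1 ->
  c' ^+ 2 + s' ^+ 2 = 1 -> 0 < s -> 0 < s' -> c / s = c' / s' ->
  c = c' /\ s = s'.
Proof.
move=> cs cs' s0 s'0 /eqP.
rewrite (eqr_div _ _ (lt0r_neq0 s0) (lt0r_neq0 s'0)) => /eqP cross.
have ss' : s' = s.
  apply/eqP; rewrite -(@eqrXn2 _ 2) ?ltW //; apply/eqP.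
  have -> : s' ^+ 2 = s' ^+ 2 * (c ^+ 2 + s ^+ 2) by rewrite cs mulr1.
  have -> : s' ^+ 2 * (c ^+ 2 + s ^+ 2) =
    (c * s') ^+ 2 + s ^+ 2 * s' ^+ 2 by ring.
  have -> : s ^+ 2 = s ^+ 2 * (c' ^+ 2 + s' ^+ 2) by rewrite cs' mulr1.
  rewrite cross cs' mulr1.
  have -> : s' ^+ 2 = 1 - c' ^+ 2 by rewrite -cs'; ring.
  by ring.
by move: cross; rewrite ss' => /(mulIf (negbT (gt_eqF s0))).
Qed.

(** In this section (e, w, k) is a frame such that N stays in the plane of e
and k, on the side where <N, e> < 0.  The coordinates of the surface in the
frame are xx, yy, zz, and N = cn k - sn e. *)
Section Charts.
Context {R : realType} (k e w : 'rV[R]_3) (fr : frame e w k).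
Context (B : set 'rV[R]_2) (oB : open B) (r N : 'rV[R]_2 -> 'rV[R]_3).
Hypotheses (hr : immersion B r) (hN : unit_normal B r N).
Hypothesis plane : forall q, B q -> dot (N q) w = 0.
Hypothesis side : forall q, B q -> dot (N q) e < 0.
Context (p : 'rV[R]_2) (Bp : B p).

Let xx q := dot (r q - r p) e.
Let yy q := dot (r q - r p) w.
Let zz q := dot (r q - r p) k.
Let cn q := dot (N q) k.
Let sn q := - dot (N q) e.

Lemma cn2Dsn2 q : B q -> cn q ^+ 2 + sn q ^+ 2 = 1.
Proof.
move=> Bq; have [[ee _ kk] [_ ek _]] := fr.
have := normal_unit hN Bq; rewrite {1 2}(frame_expansion (N q) fr) plane //.
rewrite scale0r addr0 !dot_expand ee kk ek (dotC k e) ek => <-.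
by rewrite /cn /sn; ring.
Qed.

Lemma sn_gt0 q : B q -> 0 < sn q.
Proof. by move=> /side; rewrite oppr_gt0. Qed.

Lemma ndiff_coordinate z n : ndiff n B (fun q => dot (r q - r p) z).
Proof.
have /smooth_onP nr := hr.1.
apply: ndiff_dot => //; last exact: ndiff_cst.
by apply: ndiffB => //; exact: ndiff_cst.
Qed.

Lemma derive_coordinate z q v : B q ->
  'D_v (fun x => dot (r x - r p) z) q = dot ('D_v r q) z.
Proof.
move=> Bq; have dr := differentiable_immersion hr Bq.
have dc : differentiable (cst (r p) : 'rV[R]_2 -> _) q.
  exact: differentiable_cst.
rewrite (derive_dot_cst (f := r \- cst (r p))); last exact: differentiableB.
rewrite [X in dot X z](_ : _ = 'D_v r q) //.
by rewrite deriveB ?derive_cst ?subr0 //; exact: diff_derivable.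
Qed.

(** The tangency relation <D_v r, N> = 0 in frame coordinates. *)
Lemma sn_derive_xx q v : B q -> sn q * 'D_v xx q = cn q * 'D_v zz q.
Proof.
move=> Bq; rewrite !derive_coordinate //.
have [_ /(_ q Bq)[_ /(_ v)]] := hN.
rewrite {1}(frame_expansion (N q) fr) plane // !dot_expand.
rewrite !(dotC _ e) !(dotC _ k).
rewrite /cn /sn (dotC (N q) e) (dotC (N q) k); lra.
Qed.

Definition chart (h : 'rV[R]_2 -> R) q : 'rV[R]_2 :=
  \row_(i < 2) [:: h q; yy q]`_i.

Lemma chart0 h : (fun q => chart h q 0 0) = h.
Proof. by apply/funext => q; rewrite mxE. Qed.

Lemma chart1 h : (fun q => chart h q 0 1) = yy.
Proof. by apply/funext => q; rewrite mxE. Qed.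

(** If D_v h and D_v yy vanish, then so does D_v zz by hypothesis, and D_v xx
by tangency; hence D_v r = 0 and v = 0. *)
Lemma chart_jacobian_unit (h : 'rV[R]_2 -> R) q : B q ->
  differentiable h q -> (forall v, 'D_v h q = 0 -> 'D_v zz q = 0) ->
  'J (chart h) q \in unitmx.
Proof.
move=> Bq dh hz.
have dy : differentiable yy q.
  exact: ndiff_differentiable (ndiff_coordinate w 0) Bq.
have dch : differentiable (chart h) q.
  apply/differentiable_mxP => i j; rewrite ord1.
  have [-> |->] := ord2P j.
  - by rewrite chart0.
  - by rewrite chart1.
have dr := differentiable_immersion hr Bq.
rewrite -row_free_unit; apply: inj_row_free => v.
rewrite -deriveEjacobian // => /rowP chv.
have dcv := diff_derivable (v := v) dch.
have Dh : 'D_v h q = 0.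
  by have := chv 0; rewrite (derive_mx_coord 0 0 dcv) chart0 mxE.
have Dy : 'D_v yy q = 0.
  by have := chv 1; rewrite (derive_mx_coord 0 1 dcv) chart1 mxE.
have Dz := hz v Dh.
have Dx : 'D_v xx q = 0.
  have := sn_derive_xx v Bq; rewrite Dz mulr0 => /eqP.
  by rewrite mulf_eq0 (gt_eqF (sn_gt0 Bq)) => /eqP.
rewrite !derive_coordinate // in Dx Dy Dz.
have Dr : 'D_v r q = 0.
  by rewrite (frame_expansion ('D_v r q) fr) Dx Dy Dz !scale0r !addr0.
have [_ /(_ q Bq) fJ] := hr.
by apply: (row_free_inj fJ); rewrite mul0mx -deriveEjacobian.
Qed.

(** The function h is to be thought of as a reparametrized height, with
dh = m dzz.  In the chart (h, yy) the heights satisfy dzz = dh / m, and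
tangency gives dxx = (cn / sn) dzz, so that both have no derivative along the
second axis.  The lemma is applied to h = zz, and then to the arc length of the
profile curve. *)
Lemma chart_inverse (V0 : set 'rV[R]_2) (h m : 'rV[R]_2 -> R) :
  open V0 -> V0 p -> V0 `<=` B -> smooth_on V0 h -> h p = 0 ->
  (forall q, V0 q -> m q != 0) ->
  (forall q v, V0 q -> 'D_v h q = 'D_v zz q * m q) ->
  exists (V : set 'rV[R]_2) (F : 'rV[R]_2 -> 'rV[R]_2) (d : R),
  [/\ [/\ open V, V p & V `<=` V0], 0 < d,
      smooth_on V (chart h) /\ smooth_on (ball 0 d) F,
      forall q, ball 0 d q -> V (F q) /\ chart h (F q) = q &
      forall x, V x -> ball 0 d (chart h x) /\ F (chart h x) = x] /\
  [/\ forall q, ball 0 d q ->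
        differentiable (zz \o F) q /\ differentiable (xx \o F) q,
      forall q v, ball 0 d q -> 'D_v (zz \o F) q = v 0 0 / m (F q) &
      forall q v, ball 0 d q ->
        'D_v (xx \o F) q = v 0 0 / m (F q) * (cn (F q) / sn (F q))].
Proof.
move=> oV0 V0p V0B sh hp0 m0 dh.
have nh := (smooth_onP V0 h).1 sh.
have sch : smooth_on V0 (chart h).
  apply/smooth_onP => n; apply/(ndiff_mxP oV0) => i j; rewrite ord1.
  have [-> |->] := ord2P j.
  - by rewrite chart0; exact: nh.
  - by rewrite chart1; exact: ndiff_subset V0B (ndiff_coordinate w n).
have dhV q : V0 q -> differentiable h q by exact: ndiff_differentiable (nh 0).
have uJ : 'J (chart h) p \in unitmx.
  apply: chart_jacobian_unit => [//||v]; first exact: dhV.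
  by rewrite dh // => /eqP; rewrite mulf_eq0 (negbTE (m0 p V0p)) orbF => /eqP.
have chp : chart h p = 0.
  apply/rowP => j; rewrite !mxE hp0 /yy subrr dot0l.
  by case: j => -[|[|//]].
have [V [F [d [hV d0 sF FV VF]]]] := inverse_function oV0 sch V0p uJ.
rewrite chp in sF FV VF.
exists V, F, d; have [oV Vp VV0] := hV.
split.
  by split=> //; split=> // s q /VV0; exact: sch.
have dF q : ball 0 d q -> differentiable F q by move=> Bq; exact: (sF [::]).
have BF q : ball 0 d q -> V0 (F q) /\ B (F q).
  by move=> /FV[/VV0 ? _]; split=> //; exact: V0B.
have dz q : ball 0 d q -> differentiable zz (F q).
  move=> /BF[_ BFq]; exact: ndiff_differentiable (ndiff_coordinate k 0) BFq.
have dx q : ball 0 d q -> differentiable xx (F q).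
  move=> /BF[_ BFq]; exact: ndiff_differentiable (ndiff_coordinate e 0) BFq.
have DzF q v : ball 0 d q -> 'D_v (zz \o F) q = v 0 0 / m (F q).
  move=> Bq; have [V0F BFq] := BF q Bq.
  rewrite derive_chain; [|exact: dF|exact: dz].
  suff <- : 'D_('D_v F q) zz (F q) * m (F q) = v 0 0 by rewrite mulfK // m0.
  rewrite -dh // -derive_chain; [|exact: dF|exact: dhV].
  rewrite -(derive_coord q v 0); apply: near_eq_derive.
  have : \forall x \near q, ball 0 d x.
    by apply: open_nbhs_nbhs; split=> //; exact: ball_open.
  by apply: filterS => x /FV[_ /rowP/(_ 0)]; rewrite mxE.
split=> // [q Bq|q v Bq].
  split; apply: differentiable_comp; try exact: dF.
    exact: dz.
  exact: dx.
have [V0F BFq] := BF q Bq.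
rewrite -DzF // [LHS]derive_chain; [|exact: dF|exact: dx].
rewrite [in RHS]derive_chain; [|exact: dF|exact: dz].
have s0 : sn (F q) != 0 by rewrite gt_eqF // sn_gt0.
apply: (mulfI s0); rewrite sn_derive_xx //; field.
exact: s0.
Qed.

Hypothesis hk : dot k k = 1.
Hypothesis htheta : forall q, B q ->
  0 < angle k N q < pi /\ angle k N q != pi / 2.

Lemma ndiff_cn n : ndiff n B cn.
Proof.
have nN := (smooth_onP B N).1 hN.1 n.
by apply: ndiff_dot => //; exact: ndiff_cst.
Qed.

Lemma ndiff_sn n : ndiff n B sn.
Proof.
have nN := (smooth_onP B N).1 hN.1 n.
by apply: ndiffN => //; apply: ndiff_dot => //; exact: ndiff_cst.
Qed.

(** In the chart (zz, yy), xx is a function of the first coordinate, hence so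
is its derivative cn / sn along it; the unit vector (cn, sn) of the upper half
plane is determined by this cotangent. *)
Lemma height_determines_normal :
  exists (V : set 'rV[R]_2) (d : R) (C S : R -> R),
  [/\ [/\ open V, V p & V `<=` B], 0 < d,
      forall q, V q ->
        [/\ ball (0 : R) d (zz q), cn q = C (zz q) & sn q = S (zz q)] &
      forall t, ball (0 : R) d t -> 0 < S t /\ {for t, continuous S}].
Proof.
have szz : smooth_on B zz.
  by apply/smooth_onP => n; exact: ndiff_coordinate.
have zz0 : zz p = 0 by rewrite /zz subrr dot0l.
have [||V [F [d [[hV d0 [_ sF] FV VF] [dzx _ Dx]]]]] :=
  @chart_inverse B zz (cst 1) oB Bp (@subset_refl _ B) szz zz0.
- by move=> q _; exact: oner_neq0.
- by move=> q v _; rewrite mulr1.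
have [oV Vp VB] := hV.
have BF q : ball 0 d q -> B (F q) by move=> /FV[/VB].
have xxE q : ball 0 d q -> (xx \o F) q = (xx \o F) (axis (q 0 0)).
  apply: fibre_constant => x Bx; split; first by have [] := dzx x Bx.
  by rewrite Dx // !mxE /= !mul0r.
have normalE q : ball 0 d q ->
    cn (F q) = cn (F (axis (q 0 0))) /\ sn (F q) = sn (F (axis (q 0 0))).
  move=> Bq; have Ba := ball_axis (ball_coord 0 Bq).
  have dxx x : ball 0 d x -> differentiable (xx \o F) x by move=> /dzx[].
  have := derive_fibre_constant (delta_mx 0 0) dxx xxE Bq.
  rewrite !Dx // !mxE /= !divr1 !mul1r.
  apply: unit_circle_cot; try exact: cn2Dsn2 (BF _ _).
  - exact: sn_gt0 (BF _ Bq).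
  - exact: sn_gt0 (BF _ Ba).
exists V, d, (fun t => cn (F (axis t))), (fun t => sn (F (axis t))); split=> //.
- move=> q Vq; have [Bq Fq] := VF q Vq.
  have [cE sE] := normalE _ Bq; rewrite Fq mxE /= in cE sE.
  by split=> //; have := ball_coord 0 Bq; rewrite mxE.
move=> t Bt; have Ba := ball_axis Bt; split; first exact: sn_gt0 (BF _ Ba).
have dsF : differentiable (sn \o F) (axis t).
  apply: differentiable_comp; first exact: (sF [::]).
  exact: ndiff_differentiable (ndiff_sn 0) (BF _ Ba).
have [dS _] := is_derive_axis dsF.
by apply: differentiable_continuous; apply/derivable1_diffP.
Qed.

Lemma sin_angle q : B q -> sin (angle k N q) = sn q.
Proof.
move=> Bq; have [c_gt c_lt _ _] := cos_angle_bounds hk hN htheta Bq.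
rewrite /angle sin_acos; last by apply/andP; split; exact: ltW.
have -> : 1 - dot (N q) k ^+ 2 = sn q ^+ 2.
  by rewrite -(cn2Dsn2 Bq) /cn; ring.
by rewrite sqrtr_sqr ger0_norm // ltW // sn_gt0.
Qed.

Hypothesis rank_one : forall q, B q ->
  let u := k - dot (N q) k *: N q in
  (forall v, exists a, 'D_v N q = a *: u) /\
  (forall t, 'D_t r q = u -> 'D_t N q != 0).

(** Along a tangent vector t representing U one has D_t N = a U with a <> 0,
so that D_t cn = a <U, k> = a <U, U>. *)
Lemma cn_derivative_neq0 q : B q -> exists t, 'D_t cn q != 0.
Proof.
move=> Bq; have [DN DN0] := rank_one Bq.
set u := k - dot (N q) k *: N q in DN DN0.
have N1 := normal_unit hN Bq.
have uN : dot u (N q) = 0 by rewrite /u !dot_expand N1 mulr1 dotC subrr.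
have Dt := derive_tangent_lift hr hN Bq uN.
set t := u *m _ in Dt; exists t.
have [a DtN] := DN t; have := DN0 t Dt.
rewrite derive_dot_cst; last exact: (differentiable_normal hN Bq).
rewrite DtN dotZl scaler_eq0 negb_or => /andP[a0 u0].
rewrite mulf_neq0 // [dot u k](_ : _ = dot u u) ?dot_eq0 //.
by rewrite {3}/u dotBr dotZr uN mulr0 subr0.
Qed.

(** The arc length X = g o zz of the profile curve, where g is a primitive of
1 / sn as a function of the height, is smooth because its differential
dzz / sn is.  In the chart (X, yy) the functions xx, zz and cn depend on the
first coordinate x only, with dzz / dx = sn and dxx / dx = cn; the angle theta
is acos cn, whose derivative involves 1 / sn. *)
Lemma framed_cylinder_exists : framed_cylinder k B r p.
Proof.
have [V1 [d1 [C [S [[oV1 V1p V1B] d1_gt0 V1P SP]]]]] :=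
  height_determines_normal.
pose I1 := ball (0 : R) d1.
have oI1 : open I1 by exact: ball_open.
have itv_ball (d : R) : is_interval (ball (0 : R) d).
  move=> x y; rewrite -!ball_normE /= !sub0r !normrN => xd yd z /andP[xz zy].
  rewrite sub0r normrN; move: xd yd; rewrite !ltr_norml.
  move=> /andP[? ?] /andP[? ?].
  by apply/andP; split; lra.
have I10 : I1 0 by exact: ballxx.
pose g t := oriented_integral 0 t (fun s => (S s)^-1).
have dg t : I1 t -> is_derive t 1 g (S t)^-1.
  move=> It; apply: (is_derive_oriented_integral oI1 (itv_ball d1) I10 It).
  by move=> y /SP[S0 cS]; apply: cvgV => //; rewrite gt_eqF.
have dzz q : B q -> differentiable zz q.
  exact: ndiff_differentiable (ndiff_coordinate k 0).
pose X := g \o zz.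
have dX q v : V1 q -> differentiable X q /\ 'D_v X q = 'D_v zz q * (sn q)^-1.
  move=> Vq; have [Iz _ ->] := V1P q Vq.
  exact: is_derive_chain_real v (dzz q (V1B q Vq)) (dg _ Iz).
have sX : smooth_on V1 X.
  have dX0 q : V1 q -> differentiable X q by move=> Vq; have [] := dX q 0 Vq.
  apply/smooth_onP => -[|n]; first by split.
  split=> // v.
  apply: (eq_ndiff oV1 (f := fun q => 'D_v zz q * (sn q)^-1)) => [q Vq|].
    by have [_ ->] := dX q v Vq.
  apply: ndiffM => //.
    by have [_ /(_ v)] := ndiff_coordinate k n.+1; exact: ndiff_subset.
  apply: ndiffV => //; last exact: ndiff_subset V1B (ndiff_sn n).
  by move=> q /V1B/sn_gt0/lt0r_neq0.
have X0 : X p = 0 by rewrite /X /= /zz subrr dot0l /g oriented_integralxx.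
have snV0 q : V1 q -> (sn q)^-1 != 0.
  by move=> /V1B/sn_gt0 s0; rewrite invr_neq0 // lt0r_neq0.
have [V [F [d [[hV d0 [sch sF] FV VF] [dzx Dz Dx]]]]] :=
  chart_inverse oV1 V1p V1B sX X0 snV0 (fun q v Vq => (dX q v Vq).2).
have [oV Vp VV1] := hV.
have oW : open (ball (0 : 'rV[R]_2) d) by exact: ball_open.
have BF q : ball 0 d q -> B (F q) by move=> /FV[/VV1/V1B].
have dF q : ball 0 d q -> differentiable F q by move=> Bq; exact: (sF [::]).
have zzE q : ball 0 d q -> (zz \o F) q = (zz \o F) (axis (q 0 0)).
  apply: fibre_constant => x Bx; split; first by have [] := dzx x Bx.
  by rewrite Dz // !mxE /= mul0r.
have xxE q : ball 0 d q -> (xx \o F) q = (xx \o F) (axis (q 0 0)).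
  apply: fibre_constant => x Bx; split; first by have [] := dzx x Bx.
  by rewrite Dx // !mxE /= !mul0r.
(* cn is a function of the height zz, and zz is a function of x *)
have cnE q : ball 0 d q -> (cn \o F) q = (cn \o F) (axis (q 0 0)).
  move=> Bq; have Ba := ball_axis (ball_coord 0 Bq); rewrite /=.
  have [_ -> _] := V1P _ (VV1 _ (FV q Bq).1).
  have [_ -> _] := V1P _ (VV1 _ (FV _ Ba).1).
  by congr C; exact: zzE.
have dcnF q : ball 0 d q -> differentiable (cn \o F) q.
  move=> Bq; apply: differentiable_comp; first exact: dF.
  exact: ndiff_differentiable (ndiff_cn 0) (BF q Bq).
pose I := ball (0 : R) d; have oI : open I by exact: ball_open.
pose P x := F (axis x); pose theta x := angle k N (P x).
have BP x : I x -> B (P x) by move=> /ball_axis; exact: BF.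
have bounds x : I x -> [/\ -1 < cn (P x), cn (P x) < 1, cn (P x) != 0 &
    cos (theta x) = cn (P x)].
  by move=> /BP; exact: (cos_angle_bounds hk hN htheta).
have sin_theta x : I x -> sin (theta x) = sn (P x).
  by move=> /BP; exact: sin_angle.
have dcnP x : I x ->
    is_derive x 1 (cn \o P) ('D_(delta_mx 0 0) (cn \o F) (axis x)).
  by move=> Ix; apply: (is_derive_axis (f := cn \o F)); apply/dcnF/ball_axis.
have dtheta x v : I x -> differentiable theta x /\
    'D_v theta x = 'D_v (cn \o P) x * - (sn (P x))^-1.
  move=> Ix; have [c_gt c_lt _ _] := bounds x Ix.
  have dc : differentiable (cn \o P) x.
    by apply/derivable1_diffP; have [] := dcnP x Ix.
  have c11 : -1 < (cn \o P) x < 1 by apply/andP.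
  have [d_ D_] := is_derive_chain_real v dc (is_derive1_acos c11).
  split; first exact: d_.
  rewrite -sin_theta // -[theta x]/(acos (cn (P x))) sin_acos //.
  by apply/andP; split; exact: ltW.
have nF n : ndiff n (ball 0 d) F by exact: (smooth_onP _ F).1.
have ncnP n : ndiff n I (cn \o P).
  have ncF := ndiff_comp_real oW BF (nF n) (ndiff_cn n).
  exact: (ndiff_comp_real oI (@ball_axis R d) (ndiff_axis n oI) ncF).
have nsnP n : ndiff n I (sn \o P).
  have nsF := ndiff_comp_real oW BF (nF n) (ndiff_sn n).
  exact: (ndiff_comp_real oI (@ball_axis R d) (ndiff_axis n oI) nsF).
have stheta : smooth_on I theta.
  have dtheta0 x : I x -> differentiable theta x.
    by move=> Ix; have [] := dtheta x 0 Ix.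
  apply/smooth_onP => -[|n]; first by split.
  split=> // v.
  apply: (eq_ndiff oI (f := fun x => 'D_v (cn \o P) x * - ((sn \o P) x)^-1)).
    by move=> x Ix; have [_ ->] := dtheta x v Ix.
  apply: ndiffM => //; first by have [_ /(_ v)] := ncnP n.+1.
  apply: ndiffN => //; apply: ndiffV => //.
  by move=> x /BP/sn_gt0/lt0r_neq0.
have theta'0 x : I x -> derive1 theta x != 0.
  move=> Ix; have Ba := ball_axis Ix.
  rewrite derive1E; have [_ ->] := dtheta x 1 Ix.
  rewrite mulf_neq0 //; last first.
    by rewrite oppr_eq0 invr_eq0; exact: (lt0r_neq0 (sn_gt0 (BP x Ix))).
  have [_ ->] := dcnP x Ix.
  (* if cn had no derivative along the first axis, it would have none at all *)
  have [t] := cn_derivative_neq0 (BF _ Ba); apply: contra_neq => Dcn0.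
  have [VF0 chF] := FV _ Ba.
  have dch : differentiable (chart X) (F (axis x)) by exact: (sch [::]).
  have tE : 'D_('D_t (chart X) (F (axis x))) F (axis x) = t.
    have := derive_inverse t oV VF0 (fun y Vy => (VF y Vy).2) dch.
    by rewrite chF; apply; exact: dF.
  rewrite -tE -derive_chain; [|exact: dF|]; last first.
    exact: ndiff_differentiable (ndiff_cn 0) (BF _ Ba).
  by rewrite (derive_fibre_constant _ dcnF cnE Ba) axis_coord Dcn0 mulr0.
exists V, (ball 0 d), F, I, theta, (xx \o P), (zz \o P), e, w, (r p).
split=> //.
- by split=> //; apply: subset_trans V1B.
- split=> //; split=> //; exists (chart X); split=> // q Bq.
- split=> //; [exact: itv_ball|exact: ballxx|move=> x Ix].
  have Ba := ball_axis Ix.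
  have s0 := lt0r_neq0 (sn_gt0 (BP x Ix)).
  have [ht0 ht1] := htheta (BP x Ix); have [_ _ _ cosE] := bounds x Ix.
  split=> //; first exact: theta'0.
  + rewrite cosE; have := is_derive_axis (dzx _ Ba).2.
    rewrite Dx // !mxE /= mul1r invrK -/(P x) mulrCA mulfV // mulr1.
    exact.
  + rewrite sin_theta //; have := is_derive_axis (dzx _ Ba).1.
    by rewrite Dz // !mxE /= mul1r invrK.
move=> q Bq; split; first exact: ball_coord.
have -> : r (F q) = r p + (r (F q) - r p) by rewrite subrKC.
rewrite (frame_expansion (r (F q) - r p) fr) !addrA.
have yE : dot (r (F q) - r p) w = q 0 1.
  by have [_ /rowP/(_ 1)] := FV q Bq; rewrite mxE.
have xE : dot (r (F q) - r p) e = (xx \o P) (q 0 0) by exact: (xxE q Bq).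
have zE : dot (r (F q) - r p) k = (zz \o P) (q 0 0) by exact: (zzE q Bq).
by rewrite xE yE zE.
Qed.
End Charts.

Lemma framed_cylinder_subset (R : realType) (k : 'rV[R]_3)
    (B D : set 'rV[R]_2) (r : 'rV[R]_2 -> 'rV[R]_3) p :
  B `<=` D -> framed_cylinder k B r p -> framed_cylinder k D r p.
Proof.
move=> BD [V [W [F [I [theta [phi [psi [e [w [p0 [[oV Vp VB] ? ? ? ?]]]]]]]]]]].
exists V, W, F, I, theta, phi, psi, e, w, p0; split=> //; split=> //.
exact: subset_trans BD.
Qed.

(** e is the horizontal part of n, normalized and reversed; w completes the
frame. *)
Lemma adapted_frame_exists (R : realType) (k n : 'rV[R]_3) :
  dot k k = 1 -> dot n n = 1 -> -1 < dot n k < 1 ->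
  exists e w, [/\ frame e w k, dot n w = 0 & dot n e < 0].
Proof.
move=> kk nn /andP[c_gt c_lt]; set c := dot n k in c_gt c_lt.
have c2 : 0 < 1 - c ^+ 2 by nra.
have [s s0 sE] : exists2 s, 0 < s & s ^+ 2 = 1 - c ^+ 2.
  by exists (Num.sqrt (1 - c ^+ 2)); rewrite ?sqrtr_gt0 // sqr_sqrtr // ltW.
have s_neq0 := lt0r_neq0 s0.
have [e [ee ek nE]] : exists e,
    [/\ dot e e = 1, dot e k = 0 & n = c *: k - s *: e].
  exists ((- s^-1) *: (n - c *: k)); split.
  - rewrite !dot_expand kk nn (dotC k n) -/c.
    apply: (@etrans _ _ ((1 - c ^+ 2) / s ^+ 2)); first by field.
    by rewrite -sE mulfV // expf_neq0.
  - by rewrite !dot_expand kk -/c; ring.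
  - by rewrite scalerA mulrN mulfV // scaleN1r opprK subrKC.
have [w [ww wk we]] := orthogonal_unit_exists k e.
exists e, w; split.
- by split; split=> //; rewrite dotC.
- by rewrite nE !dot_expand (dotC k) wk (dotC e) we; ring.
- by rewrite nE !dot_expand (dotC k) ek ee mulr0 sub0r mulr1 oppr_lt0.
Qed.

Lemma framed_cylinder_of_rank_one (R : realType) (k : 'rV[R]_3)
    (D : set 'rV[R]_2) (r N : 'rV[R]_2 -> 'rV[R]_3) :
  dot k k = 1 -> open D -> immersion D r -> unit_normal D r N ->
  (forall p, D p -> 0 < angle k N p < pi /\ angle k N p != pi / 2) ->
  (forall p, D p -> let u := k - dot (N p) k *: N p in
    (forall v, exists a, 'D_v N p = a *: u) /\
    (forall t, 'D_t r p = u -> 'D_t N p != 0)) ->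
  forall p, D p -> framed_cylinder k D r p.
Proof.
move=> hk oD hr hN htheta rank_one p Dp.
have [c_gt c_lt _ _] := cos_angle_bounds hk hN htheta Dp.
have [|e [w [fr Nw Ne]]] := adapted_frame_exists hk (normal_unit hN Dp) _.
  by rewrite c_gt c_lt.
have [[_ _ _] [_ _ wk]] := fr.
have cNe := differentiable_continuous
  (differentiable_dot_cst e (differentiable_normal hN Dp)).
have nside : \forall q \near p, dot (N q) e < 0.
  exact: (cvgr_lt (FF := nbhs_filter p) _ cNe _ Ne).
have nD : \forall q \near p, D q by exact: open_nbhs_nbhs (conj oD Dp).
have [d /= d0 dP] := (nbhs_ballP p _).1 (filterI nD nside).
have BD : ball p d `<=` D by move=> q /dP[].
apply: (framed_cylinder_subset BD).
have hrB : immersion (ball p d) r.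
  by have [sr fJ] := hr; split=> [s q /BD|q /BD]; [exact: sr|exact: fJ].
have hNB : unit_normal (ball p d) r N.
  by have [sN nN] := hN; split=> [s q /BD|q /BD]; [exact: sN|exact: nN].
have dNu q : D q -> forall v, exists a,
    'D_v N q = a *: (k - dot (N q) k *: N q).
  by move=> /rank_one[].
have kw : dot k w = 0 by rewrite dotC.
apply: (framed_cylinder_exists fr (ball_open p d) hrB hNB).
- exact: (normal_in_vertical_plane hk hN htheta dNu BD kw Nw).
- by move=> q /dP[].
- exact: ballxx.
- exact: hk.
- by move=> q /BD; exact: htheta.
- by move=> q /BD; exact: rank_one.
Qed.

Theorem theorem4 (R : realType) (k : 'rV[R]_3) (hk : dot k k = 1)
    (D : set 'rV[R]_2) (hD : open D)
    (r N : 'rV[R]_2 -> 'rV[R]_3)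
    (hr : immersion D r) (hN : unit_normal D r N)
    (htheta : forall p, D p ->
       0 < angle k N p < pi /\ angle k N p != pi / 2) :
  (flat D r N /\ canonical_principal_direction k D r N)
  <-> locally_cylinder k D r.
Proof.
apply: (iff_trans (flat_canonical_iff hk hD hr hN htheta)); split=> [H|H p Dp].
  apply: framed_locally_cylinder.
  exact: framed_cylinder_of_rank_one hk hD hr hN htheta H.
have fp := locally_framed_cylinder hk H Dp.
exact: (framed_cylinder_normal_derivative hk hr hN Dp fp).
Qed.
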